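(* Let $n>1$. Any irreducible family $\{V_i:i=1,\dots,n\}$ which is a $\mathcal{U}_n$-twisted power partial isometry with respect to $\{U_{ij}\}$ is unitarily equivalent to a family of the following form. There is a partition $$\{1,2,\dots,n\}=\Phi_s\cup\Phi_b\cup\Psi\cup\Phi_u,\qquad \Psi=\bigcup_{p=1}^\infty\Phi_p,$$ into pairwise disjoint (possibly empty) sets, only finitely many $\Phi_p$ being nonempty, and a Hilbert space $\mathcal{H}_u$, such that the operators act on $$\bigotimes_{i\in\Phi_s}\ell^2(\mathbb{Z}_+)\otimes\bigotimes_{i\in\Phi_b}\ell^2(\mathbb{Z}_+)\otimes\bigotimes_{p:\,\Phi_p\ne\emptyset}\ \bigotimes_{i\in\Phi_p}\mathbb{C}^p\otimes\mathcal{H}_u$$ (one tensor factor for each $i\in\Phi_s\cup\Phi_b\cup\Psi$, called the $i$-th factor, and the factor $\mathcal{H}_u$) and are given by: - if $j\in\Phi_s$: $V_j$ acts as $D(U_{ij})$ on the $i$-th factor for $i\in\Phi_s$, $i<j$; as $S$ on the $j$-th factor; and as the identity on all other factors; - if $j\in\Phi_b$: $V_j$ acts as $D(U_{ij})$ on the $i$-th factor for all $i\in\Phi_s$; as $D(U_{ji})$ on the $i$-th factor for $i\in\Phi_b$, $i<j$; as $S^*$ on the $j$-th factor; and as the identity on all other factors; - if $j\in\Phi_p$: $V_j$ acts as $D(U_{ij})$ on the $i$-th factor for all $i\in\Phi_s$; as $D(U_{ji})$ on the $i$-th factor for all $i\in\Phi_b$; as $d(U_{ij})$ on the $i$-th factor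 for $i\in\Psi$, $i<j$; as $J_p$ on the $j$-th factor; and as the identity on all other factors; - if $j\in\Phi_u$: $V_j$ acts as $D(U_{ij})$ on the $i$-th factor for all $i\in\Phi_s$; as $D(U_{ji})$ on the $i$-th factor for all $i\in\Phi_b$; as $d(U_{ij})$ on the $i$-th factor for all $i\in\Psi$; and as a unitary $U_j$ on $\mathcal{H}_u$. Here $\{U_j:j\in\Phi_u\}$ is an irreducible family of unitary operators on $\mathcal{H}_u$ satisfying $U_i^*U_j=U_{ij}U_jU_i^*$ for $i\ne j$, $i,j\in\Phi_u$.
   Context: An operator $V$ is a power partial isometry if $V^n$ is a partial isometry for all $n\ge0$. Let $n>1$ and let $\{U_{ij}\}_{1\le i<j\le n}$ be commuting unitaries on $\mathcal{H}$, $U_{ji}:=U_{ij}^*$. A family $(V_1,\dots,V_n)$ of power partial isometries on $\mathcal{H}$ is a $\mathcal{U}_n$-twisted power partial isometry with respect to $\{U_{ij}\}_{i<j}$ if $V_i^*V_j=U_{ij}V_jV_i^*$, $V_iV_j=U_{ji}V_jV_i$ and $V_kU_{ij}=U_{ij}V_k$ for all $i,j,k$ with $i\neq j$. A family of operators is irreducible if the space is nonzero and no closed subspaces other than $0$ and the whole space reduce all the operators (the empty family is irreducible exactly on a one-dimensional space, so $\mathcal{H}_u=\mathbb{C}$ if $\Phi_u=\emptyset$). Families $(V_i)$ on $\mathcal{H}$ and $(W_i)$ on $\mathcal{K}$ are unitarily equivalent if there is one unitary $Z:\mathcal{H}\to\mathcal{K}$ with $ZV_iZ^*=W_i$ for all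 $i$. $S$ is the unilateral shift $Se_k=e_{k+1}$ on $\ell^2(\mathbb{Z}_+)$ with basis $(e_k)_{k\ge0}$; $J_p$ is the truncated shift on $\mathbb{C}^p$ with basis $e_1,\dots,e_p$: $J_pe_k=e_{k+1}$ for $k<p$, $J_pe_p=0$ (so $J_1=0$). Notation for the diagonal operators: the $U_{ij}$ commute with all $V_k$, hence with all $V_k^*$, so irreducibility makes them scalars, $U_{ij}=\lambda_{ij}I$ with $|\lambda_{ij}|=1$ and $\lambda_{ji}=\overline{\lambda_{ij}}$; in relations on other spaces $U_{ij}$ stands for the same scalar. $D(U_{ij})$ is the diagonal unitary $e_k\mapsto\lambda_{ij}^{k}e_k$ on $\ell^2(\mathbb{Z}_+)$, and $d(U_{ij})$ is the diagonal unitary $e_k\mapsto\lambda_{ij}^{k-1}e_k$ on the relevant $\mathbb{C}^q$. *)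

(* Defs.v *)
From HB Require Import structures.
From mathcomp Require Import all_boot all_order all_algebra finmap.
From mathcomp Require Import all_classical all_reals all_analysis.
From mathcomp Require Import complex.
From mathcomp Require summability.
From mathcomp Require Import ring lra.
Set Implicit Arguments.
Unset Strict Implicit.
Unset Printing Implicit Defensive.
Import Order.TTheory GRing.Theory Num.Theory.
Import numFieldNormedType.Exports.
Local Open Scope classical_set_scope.
Local Open Scope ring_scope.

HB.mixin Record NormedModule_isHilbert (R : realType) V
    & CompleteNormedModule R[i] V := {
  inner : {dot V for @Num.conj R[i]} ;
  inner_norm : forall x : V, inner x x = `|x| ^+ 2
}.

#[short(type="hilbertType")]
HB.structure Definition Hilbert (R : realType) :=
  {V of CompleteNormedModule R[i] V & NormedModule_isHilbert R V}.

Section dot_theory.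
Variables (C : numClosedFieldType) (U : lmodType C) (form : {dot U for @Num.conj C}).

Lemma dot_CauchySchwarz u v : `|form u v| ^+ 2 <= form u u * form v v.
Proof.
have [->|v0] := eqVneq v 0; first by rewrite !linear0r normr0 expr0n.
have vv0 : 0 < form v v by rewrite dnorm_gt0.
have := dnorm_ge0 form (u - (form u v / form v v) *: v).
rewrite dnormB/= dnormZ linearZr_LR/=.
set b := form v v in vv0 *; set w := form u v.
have vr : b^* = b by apply: geC0_conj; exact: ltW.
have b0 : b != 0 by rewrite gt_eqF.
have wE : (w / b)^* * w = `|w| ^+ 2 / b.
  by rewrite rmorphM fmorphV/= vr normCK mulrAC [w^* * w]mulrC.
have -> : (w / b)^* * w + ((w / b)^* * w)^* = (`|w| ^+ 2 / b) *+ 2.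
  by rewrite wE rmorphM fmorphV rmorphXn/= vr conj_normC mulr2n.
have -> : `|w / b| ^+ 2 * b = `|w| ^+ 2 / b.
  by rewrite normrM normfV (gtr0_norm vv0); field.
rewrite mulr2n opprD addrA addrK subr_ge0.
by rewrite ler_pdivrMr.
Qed.

Lemma dot_triangle u v :
  sqrtC (form (u + v) (u + v)) <= sqrtC (form u u) + sqrtC (form v v).
Proof.
rewrite -ler_sqr ?nnegrE ?addr_ge0 ?sqrtC_ge0 ?dnorm_ge0//.
rewrite sqrrD !sqrtCK dnormD/= addrAC lerD2r lerD2l.
set d := form u v.
have -> : d + d^* = 'Re d *+ 2.
  by rewrite ReE -mulr_natr divfK// pnatr_eq0.
rewrite ler_pMn2r// -sqrtCM ?nnegrE ?dnorm_ge0//.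
apply: (@le_trans _ _ `|d|); first by have [] := leif_Re_Creal d.
rewrite -ler_sqr ?nnegrE ?sqrtC_ge0 ?mulr_ge0 ?dnorm_ge0// sqrtCK.
exact: dot_CauchySchwarz.
Qed.

End dot_theory.

Section unconditional_sums.
Variables (R : realType) (I : choiceType).
Local Notation C := R[i].
Local Notation tot := (@summability.totally I).
Let totF := @summability.totally_filter I.
Existing Instance totF.

Lemma psumE (V : zmodType) (f : I -> V) A :
  summability.partial_sum f A = \sum_(i <- A) f i.
Proof. by rewrite /summability.partial_sum big_seq_fsetE. Qed.

Definition abs_bounded (f : I -> C) :=
  exists M : C, forall A : {fset I}, \sum_(i <- A) `|f i| <= M.

Lemma psum_le (f g : I -> C) (A : {fset I}) : (forall i, f i <= g i) ->
  \sum_(i <- A) f i <= \sum_(i <- A) g i.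
Proof. by move=> fg; apply: ler_sum. Qed.

Lemma psum_sub (g : I -> R) (A B : {fset I}) : (forall i, 0 <= g i) ->
  (A `<=` B)%fset -> \sum_(i <- A) g i <= \sum_(i <- B) g i.
Proof.
move=> g0 AB; rewrite (big_fsetID _ (mem A) B)/=.
have -> : [fset x in B | x \in A]%fset = A.
  apply/fsetP => x; rewrite !inE/= andbC; case: (boolP (x \in A)) => //= xA.
  by rewrite (fsubsetP AB).
by rewrite lerDl sumr_ge0.
Qed.

Lemma cvg_psum_ge0 (g : I -> R) (M : R) : (forall i, 0 <= g i) ->
  (forall A : {fset I}, \sum_(i <- A) g i <= M) ->
  exists2 l : R, [/\ 0 <= l, l <= M & forall A : {fset I}, \sum_(i <- A) g i <= l]
    & (fun A : {fset I} => (\sum_(i <- A) (g i)%:C%C : C^o)) @ tot --> (l%:C%C : C^o).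
Proof.
move=> g0 gM; set S := range (fun A : {fset I} => \sum_(i <- A) g i).
have S0 : S !=set0 by exists (\sum_(i <- fset0) g i); exists fset0.
have US : has_ubound S by exists M => _ [A _ <-].
have supS A : \sum_(i <- enum_fset A) g i <= sup S.
  by apply: ub_le_sup => //; exists A.
exists (sup S).
  split => //; last by apply: ge_sup => // _ [A _ <-].
  by have := supS fset0; rewrite big_seq_fset0.
apply/cvgrPdist_lt => -[e e']; rewrite ltcE/= => /andP[/eqP -> e0].
have [_ [A0 _ <-] A0e] := sup_adherent e0 (conj S0 US).
exists A0 => // A /= A0A.
rewrite -rmorph_sum/= -rmorphB/= normc_def/= expr0n/= addr0 sqrtr_sqr.
rewrite ltcR ger0_norm ?subr_ge0//.
rewrite ltrBlDr -ltrBlDl; apply: lt_le_trans A0e _.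
exact: psum_sub.
Qed.

Lemma normRe_le (z : C) : (`|complex.Re z|%:C%C : C) <= `|z|.
Proof.
rewrite normc_def lecR -(sqrtr_sqr (complex.Re z)) ler_wsqrtr//.
by rewrite lerDl sqr_ge0.
Qed.

Lemma normIm_le (z : C) : (`|complex.Im z|%:C%C : C) <= `|z|.
Proof.
rewrite normc_def lecR -(sqrtr_sqr (complex.Im z)) ler_wsqrtr//.
by rewrite lerDr sqr_ge0.
Qed.

Lemma cvg_psum_real (g : I -> R) (f : I -> C) :
  (forall i, (`|g i|%:C%C : C) <= `|f i|) -> abs_bounded f ->
  cvg ((fun A : {fset I} => (\sum_(i <- A) (g i)%:C%C : C^o)) @ tot).
Proof.
move=> gf [M fM].
have gM (A : {fset I}) : \sum_(i <- A) `|g i| <= complex.Re M.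
  have : (\sum_(i <- A) (`|g i|%:C%C : C)) <= M.
    by apply: le_trans (fM A); apply: psum_le.
  by rewrite -rmorph_sum/= lecE/= => /andP[].
have [l1 _ h1] := cvg_psum_ge0 (fun i => normr_ge0 (g i)) gM.
have p0 i : 0 <= `|g i| + g i by rewrite -lerBlDr sub0r -normrN ler_norm.
have pM (A : {fset I}) : \sum_(i <- A) (`|g i| + g i) <= complex.Re M + complex.Re M.
  rewrite big_split/= lerD//; apply: le_trans (gM A).
  by apply: ler_sum => i _; exact: ler_norm.
have [l2 _ h2] := cvg_psum_ge0 p0 pM.
apply/cvg_ex; exists ((l2%:C%C : C^o) - (l1%:C%C : C^o)).
apply: cvg_trans (cvgB h2 h1); apply: near_eq_cvg.
apply: nearW => A; rewrite !fctE -sumrB; apply: eq_bigr => i _.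
by rewrite rmorphD/= addrAC subrr add0r.
Qed.

Lemma cvg_psum (f : I -> C) : abs_bounded f ->
  cvg ((fun A : {fset I} => (\sum_(i <- A) f i : C^o)) @ tot).
Proof.
move=> fb.
have /cvg_ex[/= l1 h1] := cvg_psum_real (fun i => normRe_le (f i)) fb.
have /cvg_ex[/= l2 h2] := cvg_psum_real (fun i => normIm_le (f i)) fb.
have h := cvgP _ (cvgD h1 (cvgZl_tmp (k := 'i%C : C) h2)).
rewrite [X in cvg (X @ _)](_ : _ = (fun A : {fset I} =>
    (\sum_(i <- A) (complex.Re (f i))%:C%C : C^o))
  + ('i%C : C) \*: (fun A : {fset I} =>
    (\sum_(i <- A) (complex.Im (f i))%:C%C : C^o))).
  exact: h.
apply/funext => A.
change (\sum_(i <- A) f i = (\sum_(i <- A) (complex.Re (f i))%:C%C) +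
  ('i%C : C) * (\sum_(i <- A) (complex.Im (f i))%:C%C)).
rewrite mulr_sumr -big_split; apply: eq_bigr => i _.
by rewrite [in LHS](complexE (f i)).
Qed.

Definition csum (f : I -> C) : C := summability.sum (f : I -> C^o).

Lemma csum_cvg (f : I -> C) : abs_bounded f ->
  (fun A : {fset I} => (\sum_(i <- A) f i : C^o)) @ tot --> (csum f : C^o).
Proof.
move=> /cvg_psum; rewrite /csum /summability.sum.
suff -> : summability.partial_sum (f : I -> C^o) =
  (fun A : {fset I} => \sum_(i <- A) f i : C^o) by [].
by apply/funext => A; rewrite psumE.
Qed.

Lemma csum_unique (f : I -> C) (l : C) :
  (fun A : {fset I} => (\sum_(i <- A) f i : C^o)) @ tot --> (l : C^o) ->
  csum f = l.
Proof.
move=> fl; rewrite /csum /summability.sum.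
have -> : summability.partial_sum (f : I -> C^o) =
  (fun A : {fset I} => \sum_(i <- A) f i : C^o).
  by apply/funext => A; rewrite psumE.
exact: (cvg_lim (@norm_hausdorff _ C^o) fl).
Qed.

Lemma csumD f g : abs_bounded f -> abs_bounded g ->
  csum (fun i => f i + g i) = csum f + csum g.
Proof.
move=> /csum_cvg hf /csum_cvg hg; apply: csum_unique.
apply: cvg_trans (cvgD hf hg); apply: near_eq_cvg.
by apply: nearW => A; rewrite !fctE -big_split.
Qed.

Lemma csumZ a f : abs_bounded f -> csum (fun i => a * f i) = a * csum f.
Proof.
move=> /csum_cvg hf; apply: csum_unique.
apply: cvg_trans (cvgZl_tmp (k := a) hf); apply: near_eq_cvg.
by apply: nearW => A; change (a * (\sum_(i <- A) f i) = \sum_(i <- A) a * f i);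
  rewrite mulr_sumr.
Qed.

Lemma csum_conj f : abs_bounded f -> csum (fun i => (f i)^*) = (csum f)^*.
Proof.
move=> /csum_cvg hf; apply: csum_unique; apply/cvgrPdist_lt => e e0.
move/cvgrPdist_lt : hf => /(_ e e0); apply: filterS => A.
by rewrite -rmorph_sum/= -rmorphB/= norm_conjC.
Qed.

Lemma csum_ge0 f : (forall i, 0 <= f i) -> abs_bounded f ->
  [/\ 0 <= csum f, forall A : {fset I}, \sum_(i <- A) f i <= csum f &
    forall M, (forall A : {fset I}, \sum_(i <- A) f i <= M) -> csum f <= M].
Proof.
move=> f0 [M fM].
have fE i : f i = (complex.Re (f i))%:C%C.
  by rewrite (RRe_real (ger0_real (f0 i))).
have f'0 i : 0 <= complex.Re (f i) by rewrite -(ler0c (complex.Re (f i))) -fE.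
have sumE (A : {fset I}) :
    \sum_(i <- A) f i = (\sum_(i <- A) complex.Re (f i))%:C%C.
  by rewrite rmorph_sum; apply: eq_bigr => i _.
have key (N : C) : (forall A : {fset I}, \sum_(i <- A) f i <= N) ->
    N = (complex.Re N)%:C%C /\ forall A : {fset I}, \sum_(i <- A) complex.Re (f i) <= complex.Re N.
  move=> fN; have N0 : 0 <= N by have := fN fset0; rewrite big_seq_fset0.
  split; first by rewrite (RRe_real (ger0_real N0)).
  by move=> A; have := fN A; rewrite sumE lecE/= => /andP[].
have fM' (A : {fset I}) : \sum_(i <- A) f i <= M.
  by apply: le_trans (fM A); apply: psum_le => i; rewrite ger0_norm.
have [_ fReM] := key _ fM'.
have [l [l0 _ lub] hl] := cvg_psum_ge0 f'0 fReM.
have -> : csum f = l%:C%C.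
  apply: csum_unique; apply: cvg_trans hl; apply: near_eq_cvg.
  by apply: nearW => A; apply: eq_bigr => i _.
split; first by rewrite ler0c.
  by move=> A; rewrite sumE lecR.
move=> N /key[-> fN].
have [l' [_ l'N _] hl'] := cvg_psum_ge0 f'0 fN.
suff /complexI -> : (l%:C%C : C) = l'%:C%C by rewrite lecR.
by apply: (cvg_unique (@norm_hausdorff _ C^o) hl hl').
Qed.

End unconditional_sums.

Section l2_pred.
Variables (R : realType) (I : choiceType).
Local Notation C := R[i].

Definition square_summable : {pred I -> C} := [pred x |
  `[< exists M : C, forall A : {fset I}, \sum_(i <- A) `|x i| ^+ 2 <= M >]].

Lemma square_summable_submod_closed : submod_closed square_summable.
Proof.
split.
  apply/asboolP; exists 0 => A; rewrite big1// => i _.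
  by rewrite normr0 expr0n.
move=> a x y /asboolP[M xM] /asboolP[N yN]; apply/asboolP.
exists (2 * `|a| ^+ 2 * M + 2 * N) => A.
apply: (@le_trans _ _ (\sum_(i <- A) (2 * `|a| ^+ 2 * `|x i| ^+ 2 + 2 * `|y i| ^+ 2))).
  apply: ler_sum => i _ /=.
  have -> : (a *: x + y) i = a * x i + y i by [].
  rewrite -mulrA -exprMn -normrM.
  set u := a * x i; set v := y i.
  apply: (@le_trans _ _ ((`|u| + `|v|) ^+ 2)).
    by rewrite ler_sqr ?nnegrE ?addr_ge0// ler_normD.
  rewrite -subr_ge0.
  have -> : 2 * `|u| ^+ 2 + 2 * `|v| ^+ 2 - (`|u| + `|v|) ^+ 2 = (`|u| - `|v|) ^+ 2.
    by ring.
  by rewrite real_exprn_even_ge0// rpredB// ger0_real.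
rewrite big_split/= -!mulr_sumr lerD//.
  by rewrite ler_wpM2l// mulr_ge0// exprn_ge0.
by rewrite ler_wpM2l.
Qed.

HB.instance Definition _ := GRing.isSubmodClosed.Build R[i] (I -> C)
  square_summable square_summable_submod_closed.

End l2_pred.

Record l2 (R : realType) (I : choiceType) := L2 {
  l2_fun :> I -> R[i] ;
  l2P : l2_fun \in @square_summable R I }.

Section l2.
Variables (R : realType) (I : choiceType).
Local Notation C := R[i].
Local Notation tot := (@summability.totally I).
Let totF := @summability.totally_filter I.
Existing Instance totF.

HB.instance Definition _ := [isSub of l2 R I for @l2_fun R I].
HB.instance Definition _ := [Choice of l2 R I by <:].
HB.instance Definition _ := [SubChoice_isSubLmodule of l2 R I by <:].

Implicit Types x y : l2 R I.

Lemma l2_abs_bounded x y : abs_bounded (fun i => x i * (y i)^*).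
Proof.
have /asboolP[M xM] := l2P x; have /asboolP[N yN] := l2P y.
exists (M + N) => A.
apply: (@le_trans _ _ (\sum_(i <- A) (`|x i| ^+ 2 + `|y i| ^+ 2))); last first.
  by rewrite big_split lerD.
apply: ler_sum => i _; rewrite normrM norm_conjC.
set u := `|x i|; set v := `|y i|.
have ur : u \is Num.real by exact: normr_real.
have vr : v \is Num.real by exact: normr_real.
have u0 : 0 <= u by exact: normr_ge0.
have v0 : 0 <= v by exact: normr_ge0.
apply: (@le_trans _ _ (2 * (u * v))).
  by rewrite mulr_natl mulr2n lerDl mulr_ge0.
rewrite -subr_ge0.
have -> : u ^+ 2 + v ^+ 2 - 2 * (u * v) = (u - v) ^+ 2 by ring.
by rewrite real_exprn_even_ge0// rpredB.
Qed.

Definition l2_dot x y : C := csum (fun i => x i * (y i)^*).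

Lemma l2_dot_ge0 x : [/\ 0 <= l2_dot x x,
  forall A : {fset I}, \sum_(i <- A) `|x i| ^+ 2 <= l2_dot x x &
  forall M, (forall A : {fset I}, \sum_(i <- A) `|x i| ^+ 2 <= M) ->
    l2_dot x x <= M].
Proof.
have h : (fun i => x i * (x i)^*) = (fun i => `|x i| ^+ 2).
  by apply/funext => i; rewrite normCK.
have := l2_abs_bounded x x; rewrite /l2_dot h => b.
by apply: csum_ge0 => // i; rewrite exprn_ge0.
Qed.

Lemma l2_coord_le x i : `|x i| ^+ 2 <= l2_dot x x.
Proof.
have [_ h _] := l2_dot_ge0 x.
by have := h [fset i]%fset; rewrite big_seq_fset1.
Qed.

Lemma l2_bilinear : bilinear_for ( *%R : R[i] -> R[i] -> R[i])
  (@Num.conj R[i] \; *%R) l2_dot.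
Proof.
split=> [y|x] a u v.
  rewrite /l2_dot.
  have -> : (fun i => (a *: u + v) i * (y i)^*) =
      (fun i => a * (u i * (y i)^*) + v i * (y i)^*).
    by apply/funext => i; rewrite mulrA -mulrDl.
  rewrite csumD//=; last exact: l2_abs_bounded.
    by rewrite csumZ//; exact: l2_abs_bounded.
  have -> : (fun i => a * (u i * (y i)^*)) = (fun i => (a *: u) i * (y i)^*).
    by apply/funext => i; rewrite mulrA.
  exact: l2_abs_bounded.
rewrite /l2_dot.
have -> : (fun i => x i * ((a *: u + v) i)^*) =
    (fun i => a^* * (x i * (u i)^*) + x i * (v i)^*).
  apply/funext => i; rewrite mulrCA -mulrDr -rmorphM -rmorphD//.
rewrite csumD//=; last exact: l2_abs_bounded.
  by rewrite csumZ//; exact: l2_abs_bounded.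
have -> : (fun i => a^* * (x i * (u i)^*)) = (fun i => x i * ((a *: u) i)^*).
  by apply/funext => i; rewrite mulrCA -rmorphM.
exact: l2_abs_bounded.
Qed.

Lemma l2_hermitian x y :
  l2_dot x y = (-1) ^+ false * (l2_dot y x)^*.
Proof.
rewrite expr0 mul1r /l2_dot -csum_conj; last exact: l2_abs_bounded.
by congr csum; apply/funext => i; rewrite rmorphM /= conjCK mulrC.
Qed.

Lemma l2_pos x : x != 0 -> 0 < l2_dot x x.
Proof.
have [x0 _ _] := l2_dot_ge0 x.
move=> xn0; rewrite lt_neqAle x0 andbT eq_sym; apply: contraNneq xn0 => xx0.
apply/eqP/val_inj/funext => i /=; apply/eqP.
have := l2_coord_le x i; rewrite xx0 => h.
have := le_anti (introT andP (conj h (exprn_ge0 2 (normr_ge0 (x i))))).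
by move=> /eqP; rewrite expf_eq0 normr_eq0.
Qed.

HB.instance Definition _ := bilinear_isBilinear.Build R[i] (l2 R I) (l2 R I)
  R[i] _ _ l2_dot l2_bilinear.
HB.instance Definition _ := isHermitianSesquilinear.Build R[i] (l2 R I)
  false (@Num.conj R[i]) l2_dot l2_hermitian.
HB.instance Definition _ := isDotProduct.Build R[i] (l2 R I) l2_dot l2_pos.

Let form : {dot (l2 R I) for @Num.conj R[i]} := l2_dot.

Definition l2_norm x : C := sqrtC (l2_dot x x).

Lemma l2_normD x y : l2_norm (x + y) <= l2_norm x + l2_norm y.
Proof. exact: (dot_triangle form). Qed.

Lemma l2_normZ (a : C) x : l2_norm (a *: x) = `|a| * l2_norm x.
Proof.
have [x0 _ _] := l2_dot_ge0 x.
rewrite /l2_norm (dnormZ form) sqrtCM ?nnegrE ?exprn_ge0//.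
by rewrite sqrCK.
Qed.

Lemma l2_norm0_eq0 x : l2_norm x = 0 -> x = 0.
Proof. by move=> /eqP; rewrite sqrtC_eq0 (dnorm_eq0 form) => /eqP. Qed.

HB.instance Definition _ := Lmodule_isNormed.Build R[i] (l2 R I)
  l2_normD l2_normZ l2_norm0_eq0.

Lemma l2_norm_sum x (A : {fset I}) : \sum_(i <- A) `|x i| ^+ 2 <= `|x| ^+ 2.
Proof. by rewrite sqrtCK; have [_ + _] := l2_dot_ge0 x; exact. Qed.

Lemma l2_norm_le x (e : C) : 0 <= e ->
  (forall A : {fset I}, \sum_(i <- A) `|x i| ^+ 2 <= e ^+ 2) -> `|x| <= e.
Proof.
move=> e0 h; rewrite -ler_sqr ?nnegrE ?normr_ge0// sqrtCK.
by have [_ _ ->] := l2_dot_ge0 x.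
Qed.

Lemma l2_coord_norm x i : `|x i| <= `|x|.
Proof.
rewrite -ler_sqr ?nnegrE ?normr_ge0// sqrtCK; exact: l2_coord_le.
Qed.

Lemma l2_cauchy_coord (F : set_system (l2 R I)) (g : C -> R) i :
  ProperFilter F -> (forall z w : C, (`|g z - g w|%:C%C : C) <= `|z - w|) ->
  cauchy F -> cvg ((fun x : l2 R I => g (x i)) @ F).
Proof.
move=> FF glip /cauchy_ballP Fc; apply: R_complete; apply/cauchy_ballP => e e0.
have eC : 0 < (e%:C%C : C) by rewrite ltcR.
have [[P Q]/= [FP FQ] PQ] := Fc _ eC.
pose f (x : l2 R I) := g (x i).
exists (f @` P, f @` Q) => /=.
  split; [apply: filterS FP|apply: filterS FQ] => x Px; exact/imageP.
move=> [_ _] /= [[x Px <-] [y Qy <-]].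
have : ball x (e%:C%C : C) y by apply: (PQ (x, y)).
rewrite -!ball_normE/= => xye; rewrite -(ltcR `|_|).
apply: le_lt_trans (glip _ _) _; apply: le_lt_trans xye.
exact: (l2_coord_norm (x - y) i).
Qed.

Lemma l2_complete (F : set_system (l2 R I)) :
  ProperFilter F -> cauchy F -> cvg F.
Proof.
move=> FF Fc.
have Relip (z w : C) : (`|complex.Re z - complex.Re w|%:C%C : C) <= `|z - w|.
  by rewrite -raddfB; exact: normRe_le.
have Imlip (z w : C) : (`|complex.Im z - complex.Im w|%:C%C : C) <= `|z - w|.
  by rewrite -raddfB; exact: normIm_le.
have /choice[a aP] i : exists a : R, (fun x : l2 R I => complex.Re (x i)) @ F --> a.
  by apply/cvg_ex; exact: l2_cauchy_coord Relip Fc.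
have /choice[b bP] i : exists b : R, (fun x : l2 R I => complex.Im (x i)) @ F --> b.
  by apply/cvg_ex; exact: l2_cauchy_coord Imlip Fc.
pose L i : C := (a i +i* b i)%C.
have near_coord i (d : R) : 0 < d ->
    F [set y : l2 R I | `|y i - L i| ^+ 2 <= (d%:C%C : C)].
  move=> d0.
  have sd0 : 0 < Num.sqrt (d / 2) by rewrite sqrtr_gt0 divr_gt0.
  move/cvgrPdist_le : (aP i) => /(_ _ sd0) ha.
  move/cvgrPdist_le : (bP i) => /(_ _ sd0) hb.
  apply: filterS2 ha hb => y ha hb /=.
  rewrite -add_Re2_Im2 lecR !raddfB/=.
  have sq (r s : R) : `|r - s| <= Num.sqrt (d / 2) -> (s - r) ^+ 2 <= d / 2.
    have h0 : 0 <= d / 2 by rewrite ltW// divr_gt0.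
    rewrite -ler_sqr ?nnegrE ?sqrtr_ge0//.
    by rewrite (sqr_sqrtr h0) (real_normK (num_real _)) -sqrrN opprB.
  by rewrite (le_trans (lerD (sq _ _ ha) (sq _ _ hb)))// -splitr.
have near_sum (s : seq I) (d : R) : 0 < d ->
    F [set y : l2 R I | \sum_(i <- s) `|y i - L i| ^+ 2 <= (d%:C%C : C)].
  elim: s d => [|i s IH] d d0.
    by apply: filterE => y /=; rewrite big_nil ler0c ltW.
  have d20 : 0 < d / 2 by rewrite divr_gt0.
  apply: filterS2 (near_coord i _ d20) (IH _ d20) => y h1 h2 /=.
  by rewrite big_cons (splitr d) rmorphD lerD.
have close (e : R) : 0 < e -> F [set x : l2 R I | forall A : {fset I},
    \sum_(i <- A) `|x i - L i| ^+ 2 <= ((2 * e)%:C%C : C) ^+ 2].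
  move=> e0; move/cauchy_ballP : Fc => Fc.
  have eC : 0 < (e%:C%C : C) by rewrite ltcR.
  have [[P Q]/= [FP FQ] PQ] := Fc _ eC.
  apply: filterS FP => x Px A.
  have e20 : 0 < e ^+ 2 by rewrite exprn_gt0.
  have [y [Qy yA]] := filter_ex (filterI FQ (near_sum A _ e20)).
  have : ball x (e%:C%C : C) y by apply: (PQ (x, y)).
  rewrite -!ball_normE/= => /ltW xye.
  have xyA := le_trans (l2_norm_sum (x - y) A) (lerXn2r 2 _ _ xye).
  apply: (@le_trans _ _ (\sum_(i <- A) (2 * `|(x - y) i| ^+ 2 + 2 * `|y i - L i| ^+ 2))).
    apply: ler_sum => i _.
    have -> : x i - L i = (x - y) i + (y i - L i).
      by rewrite addrA subrK.
    set u := (x - y) i; set v := y i - L i.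
    apply: (@le_trans _ _ ((`|u| + `|v|) ^+ 2)).
      by rewrite ler_sqr ?nnegrE ?addr_ge0// ler_normD.
    rewrite -subr_ge0.
    have -> : 2 * `|u| ^+ 2 + 2 * `|v| ^+ 2 - (`|u| + `|v|) ^+ 2 = (`|u| - `|v|) ^+ 2.
      by ring.
    by rewrite real_exprn_even_ge0// rpredB// ger0_real.
  rewrite big_split/= -!mulr_sumr.
  have -> : ((2 * e)%:C%C : C) ^+ 2 = 2 * (e%:C%C) ^+ 2 + 2 * (e ^+ 2)%:C%C.
    by rewrite rmorphM rmorphXn/= rmorph_nat; ring.
  have eN : (e%:C%C : C) \is Num.nneg by rewrite nnegrE ltW.
  by rewrite lerD// ler_wpM2l// xyA// nnegrE normr_ge0.
have Lss : L \in @square_summable R I.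
  have [x hx] := filter_ex (close 1 ltr01).
  have -> : L = (x : I -> C) - ((x : I -> C) - L) by rewrite opprB addrC subrK.
  rewrite rpredB ?l2P//; apply/asboolP; eexists; exact: hx.
pose l : l2 R I := L2 Lss.
apply/cvg_ex; exists l; apply/cvgrPdist_le => e e0.
have eE : e = ((2 * (complex.Re e / 2))%:C%C : C).
  by rewrite mulrC divfK// (RRe_real (ger0_real (ltW e0))).
have e20 : 0 < complex.Re e / 2.
  by rewrite divr_gt0//; move: e0; rewrite ltcE => /andP[].
apply: filterS (close _ e20) => x hx; rewrite distrC.
by apply: l2_norm_le; [exact: ltW|rewrite {1}eE].
Qed.

HB.instance Definition _ := Uniform_isComplete.Build (l2 R I) l2_complete.

Lemma l2_inner_norm x : form x x = `|x| ^+ 2.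
Proof. by rewrite sqrtCK. Qed.

HB.instance Definition _ := NormedModule_isHilbert.Build R (l2 R I) l2_inner_norm.

End l2.

Record bounded_operator (R : realType) (H K : hilbertType R) := BoundedOperator {
  operator_fun :> {linear H -> K} ;
  operator_continuous : continuous operator_fun }.

Section operators.
Variable R : realType.
Implicit Types H K : hilbertType R.

(* [xget] picks the vector representing [x |-> inner (T x) y]; it exists, by the
   Riesz theorem, and is unique as soon as T is linear and bounded. *)
Definition adjoint H K (T : H -> K) (y : K) : H :=
  xget 0 [set z : H | forall x, inner (T x) y = inner x z].

Definition unitary_operator H K (T : bounded_operator H K) :=
  cancel T (adjoint T) /\ cancel (adjoint T) T.

Definition partial_isometry H (T : H -> H) :=
  forall x, (forall y, T y = 0 -> inner x y = 0) -> `|T x| = `|x|.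

Definition power_partial_isometry H (T : bounded_operator H H) :=
  forall m, partial_isometry (iter m T).

Definition linear_subspace H (M : set H) :=
  M 0 /\ forall (a : R[i]) x y, M x -> M y -> M (a *: x + y).

Definition orthocomplement H (M : set H) : set H :=
  [set x | forall y, M y -> inner x y = 0].

Definition reduces H (M : set H) (T : H -> H) :=
  (forall x, M x -> M (T x)) /\
  (forall x, orthocomplement M x -> orthocomplement M (T x)).

Definition irreducible_family (J : Type) H (T : J -> bounded_operator H H) :=
  (exists x : H, x != 0) /\
  forall M : set H, closed M -> linear_subspace M -> (forall j, reduces M (T j)) ->
    M = [set 0] \/ M = setT.

Definition unitarily_equivalent (J : Type) H K
    (V : J -> bounded_operator H H) (W : J -> bounded_operator K K) :=
  exists2 Z : bounded_operator H K, unitary_operator Z &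
    forall j y, Z (V j (adjoint Z y)) = W j y.

Section twisted.
Variables (n : nat) (H : hilbertType R).
Implicit Types (U : 'I_n -> 'I_n -> bounded_operator H H)
  (V : 'I_n -> bounded_operator H H).

(* Only the entries U i j with i < j are data; U_ji is the adjoint of U_ij.
   The diagonal value is never used. *)
Definition twist U (i j : 'I_n) : H -> H :=
  if (i < j)%N then (U i j : H -> H) else adjoint (U j i).

Definition commuting_unitaries U :=
  (forall i j : 'I_n, (i < j)%N -> unitary_operator (U i j)) /\
  (forall i j k l : 'I_n, (i < j)%N -> (k < l)%N ->
    forall x, U i j (U k l x) = U k l (U i j x)).

Definition twisted_power_partial_isometry U V :=
  [/\ forall i, power_partial_isometry (V i),
      forall i j, i != j -> forall x,
        adjoint (V i) (V j x) = twist U i j (V j (adjoint (V i) x)),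
      forall i j, i != j -> forall x,
        V i (V j x) = twist U j i (V j (V i x)) &
      forall i j k, i != j -> forall x,
        V k (twist U i j x) = twist U i j (V k x)].

End twisted.

(* The Hilbert space tensor product of a finite family, presented by its
   elementary tensors; this determines it up to a unique unitary commuting with
   [tens]. *)
Record tensor_product (J : finType) (F : J -> hilbertType R) := TensorProduct {
  tensor_space :> hilbertType R ;
  tens : (forall j, F j) -> tensor_space ;
  tens_multilinear : forall (x : forall j, F j) (j : J) (a : R[i]) (u v : F j),
    tens (dfwith x j (a *: u + v)) = a *: tens (dfwith x j u) + tens (dfwith x j v) ;
  inner_tens : forall x y : forall j, F j,
    inner (tens x) (tens y) = \prod_j inner (x j) (y j) ;
  tens_total : closure [set w : tensor_space |
      exists (m : nat) (c : 'I_m -> R[i]) (x : 'I_m -> forall j, F j),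
        w = \sum_(k < m) c k *: tens (x k)] = setT }.

End operators.

Section model_operators.
Variables (R : realType) (I : choiceType).

(* The vector with coordinates f, or 0 if f is not square summable. *)
Definition l2_of (f : I -> R[i]) : l2 R I := insubd 0 f.

(* e_k |-> z ^ (pos k) e_k *)
Definition l2_diag (pos : I -> nat) (z : R[i]) (x : l2 R I) : l2 R I :=
  l2_of (fun k => z ^+ pos k * x k).

Lemma l2_ofE (f : I -> R[i]) : f \in @square_summable R I -> l2_of f = f :> (I -> R[i]).
Proof. by move=> fP; rewrite /l2_of -[LHS]/(val _) insubdK. Qed.

Lemma l2_diagE pos (z : R[i]) (x : l2 R I) (k : I) :
  `|z| = 1 -> l2_diag pos z x k = z ^+ pos k * x k.
Proof.
move=> z1; rewrite /l2_diag l2_ofE//; have /asboolP[M xM] := l2P x.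
apply/asboolP; exists M => A; apply: le_trans (xM A); apply: ler_sum => i _.
by rewrite normrM normrX z1 expr1n mul1r.
Qed.

End model_operators.

Definition shift (R : realType) (x : l2 R nat) : l2 R nat :=
  l2_of (fun k => if k is m.+1 then x m else 0).

(* The basis vector e_k of C^p (1 <= k <= p) has index k - 1 in 'I_p. *)
Definition truncated_shift (R : realType) (p : nat) (x : l2 R 'I_p) : l2 R 'I_p :=
  l2_of (fun k : 'I_p => if k == 0 :> nat then 0 else x (ord_pred k)).

Lemma shiftE (R : realType) (x : l2 R nat) k :
  shift x k = if k is m.+1 then x m else 0.
Proof.
rewrite /shift l2_ofE//; have /asboolP[M xM] := l2P x.
apply/asboolP; exists M => A.
apply: le_trans (xM [fset m.-1 | m in A & m != 0%N]%fset).
rewrite big_imfset/=; last first.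
  by move=> i j /andP[_ i0] /andP[_ j0] /(congr1 S); rewrite !prednK// lt0n.
rewrite big_filter [leLHS](bigID (fun m => m != 0%N))/= [X in _ + X]big1 ?addr0.
  by apply: ler_sum => -[].
by move=> [|m]//= _; rewrite normr0 expr0n.
Qed.

Lemma truncated_shiftE (R : realType) (p : nat) (x : l2 R 'I_p) (k : 'I_p) :
  truncated_shift x k = if k == 0 :> nat then 0 else x (ord_pred k).
Proof.
rewrite /truncated_shift l2_ofE//; apply/asboolP.
pose f (i : 'I_p) := `|if i == 0 :> nat then 0 else x (ord_pred i)| ^+ 2.
exists (\sum_(i <- [fset i | i : 'I_p]%fset) f i) => A.
rewrite [leRHS](big_fsetID _ (mem A))/=.
have -> : [fset i in [fset i | i : 'I_p] | i \in A]%fset = A.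
  by apply/fsetP => i; rewrite !inE/=.
by rewrite lerDl sumr_ge0// => i _; rewrite /f exprn_ge0.
Qed.

(* A partition of the index set into Phi_s, Phi_b, the Phi_p and Phi_u is the
   map sending an index to the name of the part that contains it. *)
Variant part := Phi_s | Phi_b | Phi_ of nat | Phi_u.

Definition in_Phi_u (k : part) := if k is Phi_u then true else false.

(* No tensor factor is attached to the indices of Phi_u: the values of [factor]
   and [own_action] at Phi_u are not used. *)
Definition factor (R : realType) (k : part) : hilbertType R :=
  match k with Phi_ p => l2 R 'I_p | _ => l2 R nat end.

Definition own_action (R : realType) (k : part) : factor R k -> factor R k :=
  match k with
  | Phi_s => @shift R
  | Phi_b => adjoint (@shift R)
  | Phi_ p => @truncated_shift R p
  | Phi_u => id
  end.

(* D(z) if the factor is l2(Z_+), d(z) if it is C^p *)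
Definition diag_action (R : realType) (k : part) (z : R[i]) :
    factor R k -> factor R k :=
  match k with
  | Phi_ p => l2_diag (@nat_of_ord p) z
  | _ => l2_diag id z
  end.

Section model.
Variables (R : realType) (n : nat).
Variables (Phi : 'I_n -> part) (lam : 'I_n -> 'I_n -> R[i]).

(* The action of V_j on the i-th factor, for i outside Phi_u. *)
Definition factor_action (j i : 'I_n) : factor R (Phi i) -> factor R (Phi i) :=
  if i == j then @own_action R (Phi i) else
  match Phi j, Phi i return factor R (Phi i) -> factor R (Phi i) with
  | Phi_s, Phi_s => if (i < j)%N then diag_action (lam i j) else id
  | Phi_b, Phi_s => diag_action (lam i j)
  | Phi_b, Phi_b => if (i < j)%N then diag_action (lam j i) else id
  | Phi_ _, Phi_s => diag_action (lam i j)
  | Phi_ _, Phi_b => diag_action (lam j i)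
  | Phi_ _, Phi_ _ => if (i < j)%N then diag_action (lam i j) else id
  | Phi_u, Phi_s => diag_action (lam i j)
  | Phi_u, Phi_b => diag_action (lam j i)
  | Phi_u, Phi_ _ => diag_action (lam i j)
  | _, _ => id
  end.

Definition index_u := {j : 'I_n | in_Phi_u (Phi j)}.
Definition index_factor := {i : 'I_n | ~~ in_Phi_u (Phi i)}.

Variable (Hu : hilbertType R) (Uu : index_u -> bounded_operator Hu Hu).

(* [Some i] is the index of the i-th factor and [None] that of H_u. *)
Definition model_factor (o : option index_factor) : hilbertType R :=
  if o is Some i then factor R (Phi (val i)) else Hu.

Definition model_action (j : 'I_n) (o : option index_factor) :
    model_factor o -> model_factor o :=
  match o with
  | Some i => @factor_action j (val i)
  | None => if insub j is Some j' then Uu j' else id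
  end.

End model.

(* Main.v *)
From HB Require Import structures.
Require Import Defs.
From mathcomp Require Import all_boot all_order all_algebra finmap.
From mathcomp Require Import all_classical all_reals all_analysis.
From mathcomp Require Import complex.
From mathcomp Require Import zify ring lra.
Set Implicit Arguments.
Unset Strict Implicit.
Unset Printing Implicit Defensive.
Import Order.TTheory GRing.Theory Num.Theory.
Import numFieldNormedType.Exports.
Local Open Scope classical_set_scope.
Local Open Scope ring_scope.

(** Since the U_ij commute with the irreducible family V, they are scalars
    lambda_ij (Schur's lemma, [commutant_unitary_scalar]). No spectral theorem is
    needed: a self-adjoint B in the commutant has an absolute value P, obtained as
    the limit of an elementary iteration, and the range of P - B is stable under
    the family, so that B = P or B = - P; applied to all real translates of B,
    this makes B scalar.

    Every V_j then commutes with V_i and with the adjoint of V_i up to conjugate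
    phases. Hence every subspace cut out by the initial and final projections of
    the powers of V_i reduces the whole family, and the decomposition of Halmos and
    Wallen of V_i has a single nonzero component ([ppi_classification]): V_i is
    unitary, a shift, a backward shift or a truncated shift, each with some
    multiplicity. In the last three cases H is a ladder: the orthogonal sum of the
    images A^k W_i, where A is V_i (its adjoint for a backward shift) and W_i is the
    range of a projection Q_i which is a polynomial in V_i and its adjoint. Because
    the phases cancel in Q_i, it commutes with all V_j with j different from i, and
    with all Q_j.

    The space H_u is the intersection of the W_i, reduced by the unitary V_j. An
    elementary tensor x is sent to the vector x_1(A_1) (x_2(A_2) (... x_u)), where
    x_i(A_i) stands for the sum over m of x_i(m) A_i^m ([tens_seq]). This map
    multiplies inner products ([inner_tens_seq]) because each ladder is orthogonal
    and is not disturbed by the other ones, and its range is total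
    ([tens_seq_total]). So H itself, with this map, is the tensor product of the
    model, and the unitary equivalence of the theorem is the identity. When V_j is
    applied to such a vector, it passes the factors before its own one, multiplying
    the m-th coordinate of the i-th factor by the m-th power of a phase, which is
    the diagonal operator of the model; at its own factor it acts as a shift,
    backward shift or truncated shift, and it does not reach the later ones. This
    gives the formulas of the theorem if the factors are listed in the order Phi_s,
    Phi_b, Psi and by increasing index in each of these classes ([V_tensor]).

    Finally a reducing subspace of H_u spans a reducing subspace of H, so the
    unitaries on H_u form an irreducible family ([tensor_factor_irreducible]). *)

(** * Inner products and orthogonal projections *)

Lemma conjC_real (R : realType) (r : R) : (r%:C%C : R[i])^* = r%:C%C.
Proof. by apply/CrealP; rewrite complex_real. Qed.

Section inner_theory.
Variables (R : realType) (H : hilbertType R).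
Implicit Types x y z : H.
Local Notation C := R[i].

Lemma innerDl x y z : inner (x + y) z = inner x z + inner y z.
Proof. exact: linearDl. Qed.
Lemma innerBl x y z : inner (x - y) z = inner x z - inner y z.
Proof. exact: linearBl. Qed.
Lemma innerDr x y z : inner z (x + y) = inner z x + inner z y.
Proof. exact: linearDr. Qed.
Lemma innerBr x y z : inner z (x - y) = inner z x - inner z y.
Proof. exact: linearBr. Qed.
Lemma innerZl (a : C) x z : inner (a *: x) z = a * inner x z.
Proof. exact: linearZl_LR. Qed.
Lemma innerZr (a : C) x z : inner z (a *: x) = a^* * inner z x.
Proof. exact: linearZr_LR. Qed.
Lemma inner0l z : inner 0 z = 0.
Proof. exact: linear0l. Qed.
Lemma inner0r z : inner z 0 = 0.
Proof. exact: linear0r. Qed.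
Lemma innerC x y : inner y x = (inner x y)^*.
Proof. by rewrite (hermC (@inner R H)) expr0 mul1r. Qed.

Lemma inner_eq0 x : inner x x = 0 -> x = 0.
Proof. by move=> /eqP; rewrite (dnorm_eq0 (@inner R H)) => /eqP. Qed.

Lemma inner_ext x y : (forall z, inner x z = inner y z) -> x = y.
Proof.
by move=> xy; apply/eqP; rewrite -subr_eq0; apply/eqP/inner_eq0;
   rewrite innerBl xy subrr.
Qed.

Lemma inner_extr x y : (forall z, inner z x = inner z y) -> x = y.
Proof. by move=> xy; apply: inner_ext => z; rewrite innerC xy -innerC. Qed.

(** The squared norm as a real number: the norm of H takes its values in C. *)
Definition sqn x : R := complex.Re (inner x x).

Lemma sqnE x : inner x x = (sqn x)%:C%C.
Proof. by rewrite RRe_real// ger0_real// (dnorm_ge0 (@inner R H)). Qed.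

Lemma sqn_ge0 x : 0 <= sqn x.
Proof. by rewrite -ler0c -sqnE (dnorm_ge0 (@inner R H)). Qed.

Lemma sqn_eq0 x : sqn x = 0 -> x = 0.
Proof. by move=> x0; apply: inner_eq0; rewrite sqnE x0. Qed.

Lemma sqn0 : sqn 0 = 0.
Proof. by rewrite /sqn inner0l. Qed.

Lemma sqnZ a x : (sqn (a *: x))%:C%C = `|a| ^+ 2 * (sqn x)%:C%C :> C.
Proof. by rewrite -!sqnE innerZl innerZr mulrA normCK. Qed.

Lemma sqnN x : sqn (- x) = sqn x.
Proof. by rewrite /sqn -scaleN1r innerZl innerZr rmorphN rmorph1 mulrA mulrNN mulr1 mul1r. Qed.

Lemma norm_sqn x : `|x| ^+ 2 = (sqn x)%:C%C.
Proof. by rewrite -sqnE inner_norm. Qed.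

Lemma normE x : `|x| = (Num.sqrt (sqn x))%:C%C.
Proof.
apply/eqP; rewrite -(@eqrXn2 _ 2)//; last by rewrite ler0c sqrtr_ge0.
by rewrite norm_sqn -rmorphXn/= sqr_sqrtr// sqn_ge0.
Qed.

Lemma cauchy_schwarz x y : `|inner x y| ^+ 2 <= (sqn x * sqn y)%:C%C.
Proof. by rewrite rmorphM/= -!sqnE; exact: (dot_CauchySchwarz (@inner R H)). Qed.

Lemma parallelogram x y : sqn (x + y) + sqn (x - y) = 2 * (sqn x + sqn y).
Proof.
rewrite /sqn (dnormD (@inner R H)) (dnormB (@inner R H))/=.
by rewrite !(raddfD, raddfN)/=; ring.
Qed.

Lemma cauchy_limit (u : nat -> H) :
  (forall e : R, 0 < e -> exists N, forall m k, (N <= m)%N -> (N <= k)%N ->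
     sqn (u m - u k) <= e) ->
  exists l : H, u @ \oo --> l /\
    forall e : R, 0 < e -> exists N, forall m, (N <= m)%N -> sqn (u m - l) <= e.
Proof.
move=> uC.
have ucvg : cvg (u @ \oo).
  apply/cauchy_cvgP/cauchy_exP => e; rewrite ltcE/= => /andP[/eqP eI e0].
  have [N hN] := uC ((complex.Re e / 2) ^+ 2) (exprn_gt0 2 (divr_gt0 e0 (ltr0Sn R 1))).
  exists (u N); exists N => // m /= Nm; rewrite -ball_normE/= normE.
  have -> : e = (complex.Re e)%:C%C by case: e eI {e0 hN} => a b /= ->.
  rewrite ltcR; apply: (@le_lt_trans _ _ (complex.Re e / 2)); last first.
    by rewrite ltr_pdivrMr// mulr_natr mulr2n ltrDl.
  rewrite -(ger0_norm (ltW (divr_gt0 e0 (ltr0Sn R 1)))) -sqrtr_sqr.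
  by rewrite ler_wsqrtr// hN.
exists (lim (u @ \oo)); split => // e e0.
have se0 : 0 < ((Num.sqrt e)%:C%C : C) by rewrite ltcR sqrtr_gt0.
move/cvgrPdist_le : ucvg => /(_ _ se0)[N _ hN]; exists N => m Nm.
have := hN _ Nm; rewrite /= normE lecR ler_sqrt; last exact: ltW.
by rewrite -sqnN opprB.
Qed.

Lemma orthocomplement_linear (G : set H) : linear_subspace (orthocomplement G).
Proof.
split=> [y _|a x y Gx Gy z Gz]; first by rewrite inner0l.
by rewrite innerDl innerZl Gx// Gy// mulr0 addr0.
Qed.

Lemma inner_continuous y : continuous ((fun x => inner x y) : H -> C^o).
Proof.
move=> x; apply/cvgrPdist_le => e; rewrite ltcE/= => /andP[/eqP eI e0].
have eE : e = (complex.Re e)%:C%C by case: e eI {e0} => a b /= ->.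
have d0 : 0 < sqn y + 1 by rewrite ltr_wpDl ?sqn_ge0.
pose d : R := complex.Re e / Num.sqrt (sqn y + 1).
have dp : 0 < d by rewrite divr_gt0// sqrtr_gt0.
have dC : 0 < (d%:C%C : C) by rewrite ltcR.
have : \forall z \near x, `|x - z| <= d%:C%C.
  by have /cvgrPdist_le := @cvg_id _ (nbhs x); apply.
apply: filterS => z; rewrite normE lecR => xz.
rewrite -innerBl -(@ler_pXn2r _ 2)// ?nnegrE ?normr_ge0//; last first.
  by rewrite eE ler0c ltW.
apply: le_trans (cauchy_schwarz _ _) _; rewrite eE -rmorphXn/= lecR.
have : sqn (x - z) <= d ^+ 2.
  rewrite -(sqr_sqrtr (sqn_ge0 (x - z))) ler_pXn2r// nnegrE ?sqrtr_ge0//.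
  exact: ltW.
rewrite /d expr_div_n sqr_sqrtr ?(ltW d0)// ler_pdivlMr//; apply: le_trans.
by rewrite ler_wpM2l ?sqn_ge0// lerDl.
Qed.

Lemma orthocomplement_closed (G : set H) : closed (orthocomplement G).
Proof.
have -> : orthocomplement G =
    \bigcap_(y in G) ((fun x => inner x y) @^-1` [set (0 : C^o)]).
  by apply/seteqP; split => x /= Gx y; exact: Gx.
apply: closed_bigI => y _; apply: preimage_closed; last first.
  exact: (accessible_closed_set1 (hausdorff_accessible (@norm_hausdorff _ C^o))).
by move=> x _; exact: inner_continuous.
Qed.

(** A minimizing sequence u k of the distance from x to S is Cauchy by the
    parallelogram identity. Since S need not be closed, its limit p is only
    found in the closure of S; this form of the projection theorem also gives
    density of S once its orthocomplement vanishes. *)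
Theorem projection (S : set H) (x : H) : linear_subspace S ->
  exists p, closure S p /\ orthocomplement S (x - p).
Proof.
move=> [S0 SL].
pose D := [set sqn (x - s) | s in S].
have D0 : D !=set0 by exists (sqn (x - 0)), 0.
have Dlb : has_lbound D by exists 0 => _ [s _ <-]; exact: sqn_ge0.
pose d := inf D.
have dle s : S s -> d <= sqn (x - s) by move=> Ss; apply: ge_inf => //; exists s.
have /choice[u uP] k : exists s, S s /\ sqn (x - s) <= d + k.+1%:R^-1.
  have [|_ [s Ss <-] sd] := @inf_adherent _ D (k.+1%:R^-1) _ (conj D0 Dlb).
    by rewrite invr_gt0.
  by exists s; split => //; exact: ltW.
have SB s t : S s -> S t -> S (s + t).
  by move=> Ss St; have := SL 1 _ _ Ss St; rewrite scale1r.
have SZ (a : C) s : S s -> S (a *: s).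
  by move=> Ss; have := SL a _ _ Ss S0; rewrite addr0.
have uC m k : sqn (u m - u k) <= 2 * (m.+1%:R^-1 + k.+1%:R^-1).
  have [Sm um] := uP m; have [Sk uk] := uP k.
  have := parallelogram (x - u k) (x - u m).
  have -> : x - u k - (x - u m) = u m - u k by rewrite opprB addrC addrA subrK.
  have -> : x - u k + (x - u m) = 2 *: (x - (2^-1 *: (u k + u m))).
    rewrite scalerBr scalerA divff ?pnatr_eq0// scale1r scaler_nat mulr2n.
    by rewrite opprD addrACA.
  have h : 4 * sqn (x - 2^-1 *: (u k + u m)) = sqn (2 *: (x - 2^-1 *: (u k + u m))).
    apply: complexI; rewrite sqnZ rmorphM/=; congr (_ * _).
    by rewrite ger0_norm// -natrX rmorph_nat.
  rewrite -h => hp.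
  have h2 : d <= sqn (x - 2^-1 *: (u k + u m)) by apply/dle/SZ/SB.
  move: h2 um uk hp; set a := sqn _; set b := sqn _; set c := sqn _; set e := sqn _.
  set i := _^-1; set j := _^-1.
  by move=> *; lra.
have invlt (e : R) : 0 < e -> exists N : nat, forall m, (N <= m)%N -> m.+1%:R^-1 <= e.
  move=> e0; exists (Num.truncn (e^-1)) => m Nm.
  rewrite -(invrK e) lef_pV2 ?posrE ?invr_gt0//.
  have := truncnS_gt (e^-1); move=> /ltW/le_trans; apply.
  by rewrite ler_nat ltnS.
have [p [up pl]] : exists l : H, u @ \oo --> l /\
    forall e : R, 0 < e -> exists N, forall m, (N <= m)%N -> sqn (u m - l) <= e.
  apply: cauchy_limit => e e0; have [N hN] := invlt _ (divr_gt0 e0 (ltr0Sn R 3)).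
  exists N => m k Nm Nk; apply: le_trans (uC _ _) _.
  have := hN _ Nm; have := hN _ Nk.
  by set a := k.+1%:R^-1; set b := m.+1%:R^-1 => *; lra.
exists p; split.
  apply: (closed_cvg (closure S)) up; first exact: closed_closure.
  by apply: nearW => k; apply: subset_closure; have [] := uP k.
move=> s Ss; apply/eqP; rewrite -normr_eq0 -sqrf_eq0; apply/eqP.
have sn0 := sqn_ge0 s.
(* d is a lower bound along the line u k + C s, which u k attains up to 1/(k+1);
   minimizing over the line gives the bound below *)
have hk k : `|inner (x - u k) s| ^+ 2 <= (sqn s * k.+1%:R^-1)%:C%C.
  have [Sk] := uP k; have := fun c => dle _ (SB _ _ (SZ c _ Ss) Sk).
  have xE c : x - (c *: s + u k) = x - u k - c *: s by rewrite opprD addrCA addrC.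
  under [X in X -> _]eq_forall do rewrite xE.
  move: (x - u k) => v {xE} dlev uk.
  have [s0|s0] := eqVneq (sqn s) 0.
    by rewrite s0 mul0r (sqn_eq0 s0) inner0r normr0 expr0n.
  pose c : C := inner v s / (sqn s)%:C%C.
  have := dlev c.
  rewrite -lecR -sqnE.
  rewrite innerBl !innerBr !innerZl !innerZr (innerC v s) !sqnE.
  have cE : c^* * inner v s = `|inner v s| ^+ 2 / (sqn s)%:C%C.
    rewrite /c rmorphM fmorphV/= normCK mulrAC [_^* * _]mulrC.
    by rewrite conjC_real.
  have cE' : c * (inner v s)^* = `|inner v s| ^+ 2 / (sqn s)%:C%C.
    by rewrite /c normCK mulrAC.
  have cE2 : c * (c^* * (sqn s)%:C%C) = `|inner v s| ^+ 2 / (sqn s)%:C%C.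
    by rewrite -cE mulrCA; congr (_ * _); rewrite /c divfK// fmorph_eq0.
  rewrite cE cE' cE2 subrr subr0 => h.
  have : d%:C%C + `|inner v s| ^+ 2 / (sqn s)%:C%C <= (d + k.+1%:R^-1)%:C%C.
    by rewrite -lerBrDr (le_trans h)// lerD2r lecR.
  rewrite rmorphD/= lerD2l ler_pdivrMr; last by rewrite ltcR lt_neqAle eq_sym s0.
  by rewrite rmorphM/= mulrC.
apply: le_anti; rewrite exprn_ge0// andbT.
have [s0|s0] := eqVneq (sqn s) 0.
  by rewrite (sqn_eq0 s0) inner0r normr0 expr0n.
have sp : 0 < sqn s by rewrite lt_neqAle eq_sym s0.
set w := inner _ _.
have wE : `|w| ^+ 2 = (complex.Re (`|w| ^+ 2))%:C%C.
  by rewrite RRe_real// ger0_real// exprn_ge0.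
rewrite wE lecR; apply/ler_addgt0Pl => e e0; rewrite addr0.
have e1 : 0 < e / (4 * sqn s) by rewrite divr_gt0// mulr_gt0.
have [N1 hN1] := invlt _ e1; have [N2 hN2] := pl _ e1.
pose m := maxn N1 N2.
have {hN1} h1 := hN1 m (leq_maxl _ _); have {hN2} h2 := hN2 m (leq_maxr _ _).
rewrite -lecR -wE.
have -> : w = inner (x - u m) s + inner (u m - p) s.
  by rewrite -innerDl addrA subrK.
set a := inner (x - _) s; set b := inner (_ - p) s.
apply: (@le_trans _ _ (2 * (`|a| ^+ 2 + `|b| ^+ 2))).
  rewrite -subr_ge0; apply: (@le_trans _ _ (`|a - b| ^+ 2)); first exact: exprn_ge0.
  rewrite !normCK !rmorphD/= rmorphN/= -subr_ge0.
  by rewrite [leRHS](_ : _ = 0)//; ring.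
have h3 : `|a| ^+ 2 <= (e / 4)%:C%C.
  apply: le_trans (hk m) _; rewrite lecR.
  have -> : e / 4 = sqn s * (e / (4 * sqn s)) by field; rewrite s0.
  by rewrite ler_wpM2l.
have h4 : `|b| ^+ 2 <= (e / 4)%:C%C.
  apply: le_trans (cauchy_schwarz _ _) _; rewrite lecR mulrC.
  have -> : e / 4 = sqn s * (e / (4 * sqn s)) by field; rewrite s0.
  by rewrite ler_wpM2l.
apply: le_trans (_ : _ <= 2 * ((e / 4)%:C%C + (e / 4)%:C%C)) _.
  by rewrite ler_wpM2l// lerD.
by rewrite -rmorphD/= -(rmorph_nat (real_complex R) 2) -rmorphM/= lecR; lra.
Qed.

End inner_theory.

(** * Adjoints and the Riesz theorem *)

Section adjoints.
Variable R : realType.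
Implicit Types H K L : hilbertType R.
Local Notation C := R[i].

Definition lin H K (f : H -> K) := forall (a : C) x y, f (a *: x + y) = a *: f x + f y.

(** Adjointness as a relation between bare functions: it is stable under
    composition and iteration, and it entails linearity of both sides. *)
Definition adj H K (f : H -> K) (g : K -> H) :=
  forall x y, inner (f x) y = inner x (g y).

Lemma adjC H K (f : H -> K) g : adj f g -> adj g f.
Proof. by move=> fg x y; rewrite innerC -fg -innerC. Qed.

Lemma adj_lin H K (f : H -> K) g : adj f g -> lin f.
Proof.
move=> fg a x y; apply: inner_ext => z.
by rewrite fg !innerDl !innerZl !fg.
Qed.

Lemma lin0 H K (f : H -> K) : lin f -> f 0 = 0.
Proof.
by move=> fl; have := fl (-1) 0 0; rewrite !scaleN1r !addNr.
Qed.
Lemma linD H K (f : H -> K) x y : lin f -> f (x + y) = f x + f y.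
Proof. by move=> fl; rewrite -[x]scale1r fl !scale1r. Qed.
Lemma linZ H K (f : H -> K) a x : lin f -> f (a *: x) = a *: f x.
Proof. by move=> fl; rewrite -[a *: x]addr0 fl lin0// addr0. Qed.
Lemma linB H K (f : H -> K) x y : lin f -> f (x - y) = f x - f y.
Proof. by move=> fl; rewrite -scaleN1r linD// linZ// scaleN1r. Qed.

Lemma adj_id H : adj (@id H) id. Proof. by []. Qed.

Lemma adj_comp H K L (f : H -> K) g (f' : K -> L) g' :
  adj f g -> adj f' g' -> adj (fun x => f' (f x)) (fun x => g (g' x)).
Proof. by move=> fg fg' x y; rewrite fg' fg. Qed.

Lemma adj_iter H (f g : H -> H) m : adj f g -> adj (iter m f) (iter m g).
Proof. by move=> fg; elim: m => // m IH x y; rewrite iterS fg IH -iterSr. Qed.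

Lemma adjB H K (f : H -> K) g f' g' : adj f g -> adj f' g' ->
  adj (fun x => f x - f' x) (fun x => g x - g' x).
Proof. by move=> fg fg' x y; rewrite innerBl innerBr fg fg'. Qed.

Lemma adjointE H K (f : H -> K) g : adj f g -> adjoint f = g.
Proof.
move=> fg; apply/funext => y; rewrite /adjoint; case: xgetP => [z _ zP|/(_ (g y))].
  by apply: inner_extr => x; rewrite -zP fg.
by case=> x; rewrite fg.
Qed.

Lemma closed_projection H (M : set H) (x : H) : closed M -> linear_subspace M ->
  exists p, M p /\ orthocomplement M (x - p).
Proof.
by move=> /closure_id cM ML; have [p [Mp xp]] := projection x ML; exists p; rewrite {1}cM.
Qed.

(** Riesz: a nonzero vector orthogonal to the kernel represents the functional up
    to a scalar. *)
Theorem riesz H (phi : H -> C) :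
  (forall a x y, phi (a *: x + y) = a * phi x + phi y) ->
  closed [set x | phi x = 0] -> exists z, forall x, phi x = inner x z.
Proof.
move=> philin kcl.
have phi0 : phi 0 = 0.
  by have := philin (-1) 0 0; rewrite scaleN1r addNr mulN1r addNr.
have [phiz|/existsNP[u phiu]] := pselect (forall x, phi x = 0).
  by exists 0 => x; rewrite inner0r.
have phiB a x y : phi (x - a *: y) = phi x - a * phi y.
  by rewrite addrC -scaleNr philin mulNr addrC.
have [|p [/= phip pu]] := closed_projection u kcl.
  by split=> //= a x y /= xk yk; rewrite philin xk yk mulr0 addr0.
pose v := u - p.
have phiv : phi v = phi u by rewrite /v -[p]scale1r phiB phip mulr0 subr0.
have vv0 : inner v v != 0.
  apply: contra_notN phiu => /eqP/inner_eq0 v0; by rewrite -phiv v0.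
exists ((phi v / inner v v)^* *: v) => x.
have /pu : phi (x - (phi x / phi v) *: v) = 0.
  by rewrite phiB divfK ?subrr// phiv; apply/eqP.
rewrite -/v => h; have : inner x v = (phi x / phi v) * inner v v.
  apply/eqP; rewrite -subr_eq0 -innerZl -innerBl; apply/eqP.
  by rewrite innerC h rmorph0.
rewrite innerZr conjCK => ->.
have phiv0 : phi v != 0 by rewrite phiv; apply/eqP.
by rewrite mulrCA divfK// divfK.
Qed.

Lemma continuous_adj H K (f : H -> K) : lin f -> continuous f -> adj f (adjoint f).
Proof.
move=> fl fc.
suff /choice[g gP] y : exists z, forall x, inner (f x) y = inner x z.
  by rewrite (@adjointE _ _ f g) => // x y; rewrite gP.
apply: riesz => [a x x'|]; first by rewrite fl innerDl innerZl.
have -> : [set x | inner (f x) y = 0] = f @^-1` (orthocomplement [set y]).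
  apply/seteqP; split => x /=; first by move=> h _ ->.
  exact.
apply: preimage_closed; last exact: orthocomplement_closed.
by move=> x _; exact: fc.
Qed.

Lemma bounded_continuous H K (f : H -> K) (c : R) : lin f ->
  (forall x, sqn (f x) <= c * sqn x) -> continuous f.
Proof.
move=> fl fb x.
have c0 : 0 < `|c| + 1 by rewrite ltr_wpDl.
have fb' z : sqn (f z) <= (`|c| + 1) * sqn z.
  apply: le_trans (fb z) _; rewrite ler_wpM2r ?sqn_ge0//.
  by rewrite (le_trans (ler_norm c))// lerDl.
apply/cvgrPdist_le => e; rewrite ltcE/= => /andP[/eqP eI e0].
have eE : e = (complex.Re e)%:C%C by case: e eI {e0} => a b /= ->.
pose d : R := complex.Re e / Num.sqrt (`|c| + 1).
have dp : 0 < d by rewrite divr_gt0// sqrtr_gt0.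
have dC : 0 < (d%:C%C : C) by rewrite ltcR.
have : \forall z \near x, `|x - z| <= d%:C%C.
  by have /cvgrPdist_le := @cvg_id _ (nbhs x); apply.
apply: filterS => z; rewrite normE lecR => xz.
rewrite -linB// normE eE lecR.
rewrite -(ger0_norm (ltW e0)) -sqrtr_sqr ler_wsqrtr//.
apply: le_trans (fb' _) _.
have : sqn (x - z) <= d ^+ 2.
  rewrite -(sqr_sqrtr (sqn_ge0 (x - z))) ler_pXn2r// nnegrE ?sqrtr_ge0//.
  exact: ltW.
by rewrite /d expr_div_n sqr_sqrtr ?(ltW c0)// ler_pdivlMr// mulrC.
Qed.

Lemma bounded_adj H K (f : H -> K) (c : R) : lin f ->
  (forall x, sqn (f x) <= c * sqn x) -> adj f (adjoint f).
Proof.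
by move=> fl fb; apply: continuous_adj => //; exact: bounded_continuous fl fb.
Qed.

Lemma operator_lin H K (T : bounded_operator H K) : lin T.
Proof. by move=> a x y; rewrite linearP. Qed.

Lemma operator_adj H K (T : bounded_operator H K) : adj T (adjoint T).
Proof.
by apply: continuous_adj; [exact: operator_lin|exact: operator_continuous].
Qed.

Lemma operator_bounded H K (T : bounded_operator H K) :
  exists c : R, forall x, sqn (T x) <= c * sqn x.
Proof.
have /continuous_linear_bounded/linear_boundedP bT : {for 0, continuous T}.
  exact: operator_continuous.
have [r [Tr r0]] := filter_ex (filterI bT (nbhs_pinfty_gt (real0 C))).
exists (complex.Re r ^+ 2) => x.
have rE : r = (complex.Re r)%:C%C by rewrite RRe_real// ger0_real// ltW.
have := Tr x; rewrite -(@ler_pXn2r _ 2) ?nnegrE ?mulr_ge0 ?(ltW r0)//.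
by rewrite exprMn !norm_sqn {1}rE -rmorphXn/= -rmorphM/= lecR.
Qed.

(** The form in which irreducibility is used: the orthocomplement of a set G
    stable under the operators and their adjoints is a reducing subspace, so it
    is 0 as soon as G contains a nonzero vector. *)
Lemma irreducible_total (J : Type) H (T : J -> bounded_operator H H) (G : set H) :
  irreducible_family T ->
  (forall j x, G x -> G (T j x)) -> (forall j x, G x -> G (adjoint (T j) x)) ->
  (exists2 g, G g & g != 0) -> forall z, orthocomplement G z -> z = 0.
Proof.
move=> [_ irr] GT GT' [g Gg g0] z Gz.
have st j x : orthocomplement G x -> orthocomplement G (T j x).
  by move=> Gx y Gy; rewrite operator_adj Gx//; exact: GT'.
have st' j x : orthocomplement G x -> orthocomplement G (adjoint (T j) x).
  by move=> Gx y Gy; rewrite (adjC (operator_adj _)) Gx//; exact: GT.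
have [||j|h|h] := irr (orthocomplement G).
        exact: orthocomplement_closed.
      exact: orthocomplement_linear.
    split=> [|x Gx y Gy]; first exact: st.
    by rewrite operator_adj Gx//; exact: st'.
  by have : [set 0 : H] z by rewrite -h.
have : orthocomplement G g by rewrite h.
by move=> /(_ _ Gg)/inner_eq0 g00; rewrite g00 eqxx in g0.
Qed.

End adjoints.

(** * Schur's lemma *)

Section schur.
Variables (R : realType) (H : hilbertType R).
Implicit Types (f g X Y T B : H -> H).
Local Notation C := R[i].

Definition bnd f (c : R) := forall x, `|f x| <= c%:C%C * `|x|.

Lemma bnd_comp f g a b : 0 <= a -> bnd f a -> bnd g b -> bnd (fun x => f (g x)) (a * b).
Proof.
move=> a0 fa gb x; apply: le_trans (fa _) _; rewrite rmorphM/= -mulrA.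
by rewrite ler_wpM2l ?ler0c.
Qed.

Lemma bndD f g a b : bnd f a -> bnd g b -> bnd (fun x => f x + g x) (a + b).
Proof.
move=> fa gb x; apply: le_trans (ler_normD _ _) _.
by rewrite rmorphD/= mulrDl lerD.
Qed.

Lemma bndZ f a (c : C) (c' : R) : `|c| = c'%:C%C -> bnd f a ->
  bnd (fun x => c *: f x) (c' * a).
Proof.
move=> cc fa x; rewrite normrZ cc rmorphM/= -mulrA ler_wpM2l//.
by rewrite -cc.
Qed.

Lemma bnd1P f : bnd f 1 <-> forall x, sqn (f x) <= sqn x.
Proof.
have E x : (`|f x| <= 1%:C%C * `|x|) = (sqn (f x) <= sqn x).
  by rewrite mul1r -[LHS](@ler_pXn2r _ 2) ?nnegrE// !norm_sqn lecR.
by split=> h x; have := h x; rewrite E.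
Qed.

Section sqrt.
Variable T : H -> H.
Hypotheses (TT : adj T T) (T1 : bnd T 1).

(** The iteration Y := (T + Y^2) / 2, whose limit solves (1 - Y)^2 = 1 - T,
    so that 1 - Y is a square root of 1 - T commuting with all that commutes
    with T. *)
Fixpoint sqrt_iter n x : H :=
  if n is m.+1 then 2^-1 *: (T x + sqrt_iter m (sqrt_iter m x)) else 0.

(** The same iteration for the number T = 1; its increments bound the norms of the
    increments of the operator iteration, whence the convergence. *)
Fixpoint sqrt_bound n : R := if n is m.+1 then (1 + sqrt_bound m ^+ 2) / 2 else 0.

Lemma sqrt_bound01 n : 0 <= sqrt_bound n <= 1.
Proof.
elim: n => [|n /andP[h0 h1]] /=; first by rewrite lexx ler01.
by move: h0 h1; set y := sqrt_bound n => *; apply/andP; split; nra.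
Qed.

Lemma sqrt_bound_le n : sqrt_bound n <= sqrt_bound n.+1.
Proof.
by rewrite /=; set y := sqrt_bound n; have := sqr_ge0 (y - 1); nra.
Qed.

Lemma sqrt_iter_adj n : adj (sqrt_iter n) (sqrt_iter n).
Proof.
elim: n => [|n IH] /=; first by move=> x y; rewrite inner0l inner0r.
have : (2^-1 : C)^* = 2^-1 by rewrite fmorphV/= conjC_nat.
by move=> h2 x y; rewrite innerZl innerZr h2 innerDl innerDr TT IH IH.
Qed.

Lemma sqrt_iter_comm n X : lin X -> (forall x, X (T x) = T (X x)) ->
  forall x, X (sqrt_iter n x) = sqrt_iter n (X x).
Proof.
move=> Xl XT; elim: n => [|n IH] x /=; first by rewrite lin0.
by rewrite linZ// linD// XT !IH.
Qed.

Lemma sqrt_iterC n m x : sqrt_iter n (sqrt_iter m x) = sqrt_iter m (sqrt_iter n x).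
Proof.
apply: sqrt_iter_comm => [|y]; first exact: adj_lin (sqrt_iter_adj n).
by rewrite -sqrt_iter_comm//; exact: adj_lin TT.
Qed.

Lemma sqrt_iter_bnd n : bnd (sqrt_iter n) (sqrt_bound n).
Proof.
elim: n => [|n IH] /=; first by move=> x; rewrite normr0 mul0r.
rewrite mulrC; apply: bndZ; first by rewrite fmorphV/= rmorph_nat normfV normr_nat.
apply: bndD => //; rewrite expr2; apply: bnd_comp => //.
by have /andP[] := sqrt_bound01 n.
Qed.

(** Consecutive iterates commute, so half the difference of their squares
    factors through the previous increment. *)
Lemma sqrt_iter_step n :
  bnd (fun x => sqrt_iter n.+1 x - sqrt_iter n x) (sqrt_bound n.+1 - sqrt_bound n).
Proof.
elim: n => [|n IH] x; first by rewrite [sqrt_iter 0 x]/= [sqrt_bound 0]/= !subr0; exact: sqrt_iter_bnd.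
have -> : sqrt_iter n.+2 x - sqrt_iter n.+1 x =
    2^-1 *: (sqrt_iter n.+1 (sqrt_iter n.+1 x + sqrt_iter n x)
      - sqrt_iter n (sqrt_iter n.+1 x + sqrt_iter n x)).
  rewrite !(linD _ _ (adj_lin (sqrt_iter_adj _))).
  rewrite [sqrt_iter n (sqrt_iter n.+1 x)]sqrt_iterC.
  rewrite opprD addrA addrK.
  by rewrite [sqrt_iter n.+2 x]/= [X in _ - X]/= -scalerBr opprD addrACA subrr add0r.
have -> : sqrt_bound n.+2 - sqrt_bound n.+1 =
    2^-1 * ((sqrt_bound n.+1 - sqrt_bound n) * (sqrt_bound n.+1 + sqrt_bound n)).
  have E k : sqrt_bound k.+1 = (1 + sqrt_bound k ^+ 2) / 2 by [].
  rewrite (E n.+1) [X in _ - X = _](E n).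
  by set a := sqrt_bound n.+1; set b := sqrt_bound n; field.
have h0 : 0 <= sqrt_bound n.+1 - sqrt_bound n by rewrite subr_ge0 sqrt_bound_le.
move: x; apply: bndZ; first by rewrite fmorphV/= rmorph_nat normfV normr_nat.
apply: (bnd_comp h0 IH); apply: bndD; exact: sqrt_iter_bnd.
Qed.

Lemma sqrt_iter_dist n k : (k <= n)%N ->
  bnd (fun x => sqrt_iter n x - sqrt_iter k x) (sqrt_bound n - sqrt_bound k).
Proof.
elim: n => [|n IH]; first by rewrite leqn0 => /eqP -> x; rewrite !subrr normr0 mul0r.
rewrite leq_eqVlt => /orP[/eqP -> x|]; first by rewrite !subrr normr0 mul0r.
rewrite ltnS => /IH{}IH x.
by have := bndD (sqrt_iter_step n) IH x; rewrite !addrA !subrK.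
Qed.

Lemma sqrt_iter_cvg x : exists l : H, (fun n => sqrt_iter n x) @ \oo --> l.
Proof.
pose D := range sqrt_bound.
have Dsup : has_sup D.
  split; first by exists (sqrt_bound 0), 0%N.
  by exists 1 => _ [n _ <-]; have /andP[] := sqrt_bound01 n.
have leD n : sqrt_bound n <= sup D by apply: ub_le_sup (proj2 Dsup) _ _; exists n.
have [|l [hl _]] := @cauchy_limit _ _ (fun n => sqrt_iter n x); last by exists l.
move=> e e0.
have c0 : 0 < sqn x + 1 by rewrite ltr_wpDl ?sqn_ge0.
pose d := Num.sqrt (e / (sqn x + 1)).
have d0 : 0 < d by rewrite sqrtr_gt0 divr_gt0.
have [_ [N _ <-] hN] := sup_adherent d0 Dsup.
exists N.
have wl m k : (k <= m)%N -> (N <= k)%N -> sqn (sqrt_iter m x - sqrt_iter k x) <= e.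
  move=> km Nk.
  have mono i j : (i <= j)%N -> sqrt_bound i <= sqrt_bound j.
    by move: i j; exact: (homo_leq (@lexx _ R) (@le_trans _ R) sqrt_bound_le).
  have := sqrt_iter_dist km x; set b := sqrt_bound m - sqrt_bound k.
  have b0 : 0 <= b by rewrite subr_ge0 mono.
  have bd : b <= d.
    have := leD m; have := mono _ _ Nk; rewrite /b; move: hN.
    by set u := sqrt_bound N; set v := sqrt_bound m; set w := sqrt_bound k;
       set s := sup D => *; lra.
  move=> h; have h2 := lerXn2r 2 _ _ h.
  have : `|sqrt_iter m x - sqrt_iter k x| ^+ 2 <= (b%:C%C * `|x|) ^+ 2.
    by apply: h2; rewrite ?nnegrE ?mulr_ge0 ?ler0c.
  rewrite exprMn !norm_sqn -rmorphXn/= -rmorphM/= lecR => /le_trans; apply.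
  apply: (@le_trans _ _ (d ^+ 2 * (sqn x + 1))).
    rewrite ler_pM ?sqn_ge0 ?sqr_ge0//; last by rewrite lerDl.
    by rewrite ler_pXn2r ?nnegrE// ltW.
  by rewrite sqr_sqrtr; [rewrite divfK// gt_eqF|rewrite ltW// divr_gt0].
move=> m k Nm Nk; have [mk|/ltnW km] := leqP k m; first exact: wl.
by rewrite -sqnN opprB; exact: wl.
Qed.

Lemma sqrt_limit : exists Y : H -> H,
  [/\ adj Y Y, bnd Y 1, forall x, 2 *: Y x = T x + Y (Y x) &
    forall X X', adj X X' -> (forall x, X (T x) = T (X x)) ->
      forall x, X (Y x) = Y (X x)].
Proof.
have /choice[Y hY] := sqrt_iter_cvg.
have hYi x z : (fun n => inner (sqrt_iter n x) z : C^o) @ \oo --> (inner (Y x) z : C^o).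
  exact: (cvg_comp _ _ (hY x) (@inner_continuous _ _ z (Y x))).
have uniq (u : nat -> C^o) (a b : C^o) : u @ \oo --> a -> u @ \oo --> b -> a = b.
  exact: (cvg_unique (@norm_hausdorff _ C^o)).
have conjcvg (u : nat -> C^o) (a : C^o) : u @ \oo --> a ->
    (fun n => (u n)^* : C^o) @ \oo --> (a^* : C^o).
  move=> /cvgrPdist_le h; apply/cvgrPdist_le => e e0; apply: filterS (h e e0) => n.
  by rewrite -rmorphB norm_conjC.
have YY : adj Y Y.
  move=> x z; apply: uniq (hYi x z) _.
  have -> : (fun n => inner (sqrt_iter n x) z) = (fun n => (inner (sqrt_iter n z) x)^*).
    by apply/funext => n; rewrite -innerC sqrt_iter_adj.
  by rewrite (innerC (Y z) x); exact: conjcvg.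
have Y1 : bnd Y 1.
  move=> x; rewrite mul1r !normE lecR; apply/ler_addgt0Pr => e e0.
  have eC : 0 < (e%:C%C : C) by rewrite ltcR.
  have /cvgrPdist_le/(_ _ eC)/filter_ex[n hn] := hY x.
  rewrite -lecR rmorphD/= -!normE -[Y x](subrK (sqrt_iter n x)) addrC.
  apply: le_trans (ler_normD _ _) _; rewrite lerD//.
  apply: le_trans (sqrt_iter_bnd n x) _; rewrite ler_piMl//.
  by rewrite -[1]/(1%:C%C) lecR; have /andP[] := sqrt_bound01 n.
exists Y; split => // [x|X X' XX' XT x].
  have h1 : (fun n => 2 *: sqrt_iter n.+1 x) @ \oo --> 2 *: Y x.
    by have := hY x; rewrite -cvg_shiftS => /(cvgZl_tmp (k := 2)).
  have h2 : (fun n => 2 *: sqrt_iter n.+1 x) @ \oo --> T x + Y (Y x).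
    have -> : (fun n => 2 *: sqrt_iter n.+1 x) =
        (fun n => T x + sqrt_iter n (sqrt_iter n x)).
      by apply/funext => n; rewrite /= scalerA divff ?pnatr_eq0// scale1r.
    apply: cvgD; first exact: cvg_cst.
    apply/cvgrPdist_le => e e0.
    have e20 : 0 < e / 2 by rewrite divr_gt0.
    have /cvgrPdist_le/(_ _ e20) a1 := hY x.
    have /cvgrPdist_le/(_ _ e20) a2 := hY (Y x).
    apply: filterS2 a1 a2 => n b1 b2.
    have -> : Y (Y x) - sqrt_iter n (sqrt_iter n x) =
        (Y (Y x) - sqrt_iter n (Y x)) + sqrt_iter n (Y x - sqrt_iter n x).
      by rewrite (linB _ _ (adj_lin (sqrt_iter_adj n))) addrA subrK.
    apply: le_trans (ler_normD _ _) _; rewrite [e]splitr lerD//.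
    apply: le_trans (sqrt_iter_bnd n _) _; apply: le_trans b1.
    rewrite ler_piMl// -[1]/(1%:C%C) lecR.
    by have /andP[] := sqrt_bound01 n.
  exact: (cvg_unique (@norm_hausdorff _ H) h1 h2).
apply: inner_ext => z; rewrite XX'; apply: uniq (hYi x (X' z)) _.
have -> : (fun n => inner (sqrt_iter n x) (X' z)) = (fun n => inner (sqrt_iter n (X x)) z).
  by apply/funext => n; rewrite -(@sqrt_iter_comm n X) ?XX'//; exact: adj_lin XX'.
exact: hYi.
Qed.

End sqrt.

Section irreducible.
Variables (J : Type) (V : J -> bounded_operator H H).
Hypothesis irr : irreducible_family V.

(** With P = |B| the square root of B^2, the range of P - B is stable under the
    family. If it is not 0 it is total, and (P - B)(P + B) = 0 then forces
    B = - P; otherwise B = P. *)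
Lemma commutant_sign B : adj B B -> bnd B 1 ->
  (forall j x, V j (B x) = B (V j x)) ->
  (forall x, 0 <= complex.Re (inner (B x) x)) \/
  (forall x, complex.Re (inner (B x) x) <= 0).
Proof.
move=> BB B1 BV; have Bl := adj_lin BB.
have BV' j x : adjoint (V j) (B x) = B (adjoint (V j) x).
  by apply: inner_ext => z; rewrite (adjC (operator_adj _)) !BB -BV (adjC (operator_adj _)).
pose T x := x - B (B x).
have TT : adj T T by apply: adjB; [exact: adj_id|exact: (adj_comp BB BB)].
have sqn_le y : sqn (B y) <= sqn y by have /bnd1P := B1.
have T1 : bnd T 1.
  apply/bnd1P => x.
  have -> : sqn (T x) = sqn x - 2 * sqn (B x) + sqn (B (B x)).
    rewrite /sqn /T (dnormB (@inner R H))/=.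
    have -> : inner x (B (B x)) = (sqn (B x))%:C%C by rewrite -sqnE BB.
    by rewrite conjC_real !(raddfD, raddfN)/= /sqn; ring.
  by have := sqn_le (B x); have := sqn_ge0 (B x); lra.
have [Y [YY Y1 Yeq Yc]] := sqrt_limit TT T1.
have Yl := adj_lin YY.
have YB x : B (Y x) = Y (B x).
  by apply: (Yc _ _ BB) => z; rewrite /T (linB _ _ Bl).
pose P x := x - Y x.
have PP : adj P P by apply: adjB; [exact: adj_id|].
have Pl := adj_lin PP.
have P2 x : P (P x) = B (B x).
  rewrite /P (linB _ _ Yl); have := Yeq x; rewrite scaler_nat mulr2n => h.
  have -> : Y (Y x) = Y x + Y x - T x by rewrite h [T x + _]addrC addrK.
  rewrite /T; move: (Y x) (B (B x)) => b c.
  have -> : b - (b + b - (x - c)) = x - c - b.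
    by rewrite opprB opprD addrCA [b + _]addrA subrr add0r.
  by rewrite [- (_ - b)]opprB addrA subrK opprB addrCA subrr addr0.
have P0 x : 0 <= complex.Re (inner (P x) x).
  rewrite innerBl raddfB/= subr_ge0.
  have := cauchy_schwarz (Y x) x.
  have := normRe_le (inner (Y x) x).
  move=> h1 h2; have := lerXn2r 2 _ _ h1; rewrite !nnegrE ler0c normr_ge0.
  move=> /(_ isT (normr_ge0 _))/le_trans/(_ h2); rewrite -rmorphXn/= lecR => h3.
  apply: le_trans (ler_norm _) _; rewrite -(@ler_pXn2r _ 2) ?nnegrE ?sqn_ge0//.
  apply: le_trans h3 _; rewrite expr2 ler_wpM2r ?sqn_ge0//.
  by have /bnd1P := Y1; apply.
have PB x : P (B x) = B (P x) by rewrite /P (linB _ _ Bl) YB.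
have [eqPB|/existsNP[x0 ne0]] := pselect (forall x, P x = B x).
  by left => x; rewrite -eqPB.
right => x; suff -> : B x = - P x by rewrite -scaleN1r innerZl mulN1r raddfN/= oppr_le0.
apply/eqP; rewrite -addr_eq0; apply/eqP.
pose G := range (fun x => P x - B x).
apply: (@irreducible_total _ _ _ _ G irr).
        move=> j _ [y _ <-]; exists (V j y) => //.
        rewrite (linB _ _ (@operator_lin _ _ _ _)) BV; congr (_ - _).
        rewrite /P (linB _ _ (@operator_lin _ _ _ _)); congr (_ - _).
        apply/esym/(Yc _ _ (operator_adj (V j))) => z.
        by rewrite /T (linB _ _ (@operator_lin _ _ _ _)) !BV.
      move=> j _ [y _ <-]; exists (adjoint (V j) y) => //.
      have Vl := adj_lin (adjC (operator_adj (V j))).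
      rewrite (linB _ _ Vl) BV'; congr (_ - _).
      rewrite /P (linB _ _ Vl); congr (_ - _).
      apply/esym/(Yc _ _ (adjC (operator_adj (V j)))) => z.
      by rewrite /T (linB _ _ Vl) !BV'.
    by exists (P x0 - B x0); [exists x0|rewrite subr_eq0; apply/eqP].
move=> _ [y _ <-]; rewrite -(adjB PP BB).
by rewrite (linD _ _ Pl) (linD _ _ Bl) P2 PB [B (P x) + _]addrC subrr inner0l.
Qed.

(** Every real translate A - t has a sign, so the quadratic form of A cannot take
    values on both sides of t |x|^2; hence it is a multiple of |x|^2. *)
Lemma commutant_selfadjoint_scalar A c : adj A A -> 0 <= c -> bnd A c ->
  (forall j x, V j (A x) = A (V j x)) -> exists t : C, forall x, A x = t *: x.
Proof.
move=> AA c0 Ac AV.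
pose q x : R := complex.Re (inner (A x) x).
have sgn (t : R) : (forall x, t * sqn x <= q x) \/ (forall x, q x <= t * sqn x).
  pose k := c + `|t| + 1.
  have k0 : 0 < k by rewrite ltr_wpDl// addr_ge0.
  pose B x : H := (k^-1)%:C%C *: (A x - t%:C%C *: x).
  have Bq x : complex.Re (inner (B x) x) = k^-1 * (q x - t * sqn x).
    rewrite innerZl innerBl innerZl sqnE -rmorphM/= /q.
    by case: (inner (A x) x) => a b /=; rewrite mul0r subr0.
  have adjT : adj (fun x : H => t%:C%C *: x) (fun x => t%:C%C *: x).
    by move=> x y; rewrite innerZl innerZr conjC_real.
  have [||j x|h|h] := @commutant_sign B.
  1: {
    move=> x y; rewrite innerZl innerZr conjC_real; congr (_ * _).
    exact: (adjB AA adjT). }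
  1: {
    have -> : 1 = k^-1 * k by rewrite mulVf// gt_eqF.
    apply: bndZ; first by rewrite normc_def/= expr0n addr0 sqrtr_sqr ger0_norm// invr_ge0 ltW.
    move=> x; apply: le_trans (ler_normB _ _) _; rewrite /k -addrA rmorphD/= mulrDl lerD//.
    rewrite normrZ ler_wpM2r// normc_def/= expr0n addr0 sqrtr_sqr lecR.
    by rewrite lerDl. }
  1: {
    by rewrite (linZ _ _ (@operator_lin _ _ _ _)) (linB _ _ (@operator_lin _ _ _ _)) AV
       (linZ _ _ (@operator_lin _ _ _ _)). }
  1: left => x; have := h x; rewrite Bq pmulr_rge0 ?invr_gt0// subr_ge0.
  1: by [].
  right => x; have := h x; rewrite Bq pmulr_rle0 ?invr_gt0// subr_le0.
  by [].
have [[x0 x00] _] := irr.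
have sp (x : H) : x != 0 -> 0 < sqn x.
  move=> xn0; rewrite lt_neqAle sqn_ge0 andbT eq_sym.
  by apply: contra_neq xn0 => /sqn_eq0.
pose t := q x0 / sqn x0.
have qE x : q x = t * sqn x.
  have [->|xn0] := eqVneq x 0; first by rewrite /q inner0r sqn0 mulr0.
  have s0 := sp _ x00; have s1 := sp _ xn0.
  have e0 : q x0 = t * sqn x0 by rewrite divfK// gt_eqF.
  have e1 : q x = (q x / sqn x) * sqn x by rewrite divfK// gt_eqF.
  set s := q x / sqn x in e1; rewrite e1; congr (_ * _).
  (* the midpoint of two distinct ratios would separate them *)
  have [h|h] := sgn ((s + t) / 2); have := h x; have := h x0;
    by rewrite e1 e0 !ler_pM2r// => *; lra.
exists t%:C%C => x.
(* D has a vanishing quadratic form; evaluating it at x + D x gives D x = 0 *)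
pose D x := A x - t%:C%C *: x.
have DD : adj D D.
  by move=> y z; rewrite innerBl innerBr AA innerZl innerZr conjC_real.
have D0 y : complex.Re (inner (D y) y) = 0.
  rewrite innerBl innerZl raddfB/= -/(q y) qE sqnE -rmorphM/=.
  by rewrite subrr.
apply/eqP; rewrite -subr_eq0 -/(D x); apply/eqP/sqn_eq0.
clearbody D; have := D0 (x + D x).
rewrite (linD _ _ (adj_lin DD)) innerDl !innerDr (DD (D x) x) !raddfD/=.
by rewrite !D0 add0r addr0 -/(sqn (D x)) => h; lra.
Qed.

(** Schur's lemma for a unitary, by the self-adjoint case applied to its real and
    imaginary parts. *)
Theorem commutant_unitary_scalar U U' : adj U U' ->
  (forall x, U' (U x) = x) -> (forall x, U (U' x) = x) ->
  (forall j x, V j (U x) = U (V j x)) -> (forall j x, V j (U' x) = U' (V j x)) ->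
  exists t : C, forall x, U x = t *: x.
Proof.
move=> UU' U'U UU'1 UV UV'.
have iso f g : adj f g -> (forall x, g (f x) = x) -> bnd f 1.
  by move=> fg gf; apply/bnd1P => x; rewrite /sqn fg gf.
have U1 := iso _ _ UU' U'U; have U'1 := iso _ _ (adjC UU') UU'1.
have [||j x|t1 ht1] := @commutant_selfadjoint_scalar (fun x => U x + U' x) 2 _ (ler0n _ 2).
1: by move=> x y; rewrite innerDl innerDr UU' (adjC UU') addrC.
1: exact: (bndD U1 U'1).
1: by rewrite (linD _ _ (@operator_lin _ _ _ _)) UV UV'.
have N1 : bnd (fun x => -1 *: U' x) 1.
  have h : `|-1 : C| = 1%:C%C by rewrite normrN1.
  by have := bndZ h U'1; rewrite mulr1.
have [||j x|t2 ht2] := @commutant_selfadjoint_scalar (fun x => 'i *: (U x - U' x)) 2 _ (ler0n _ 2).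
1: {
  move=> x y; rewrite innerZl innerZr conjCi innerBl innerBr UU' (adjC UU').
  by rewrite mulNr -mulrN opprB. }
1: {
  have h : `|'i : C| = 1%:C%C by rewrite normCi.
  rewrite -[X in bnd _ X]mul1r; apply: (bndZ h).
  by move=> x; rewrite -[- U' x]scaleN1r; exact: (bndD U1 N1). }
1: by rewrite (linZ _ _ (@operator_lin _ _ _ _)) (linB _ _ (@operator_lin _ _ _ _)) UV UV'.
exists ((t1 - 'i * t2) / 2) => x.
have : 2 *: U x = (t1 - 'i * t2) *: x.
  rewrite scalerBl -scalerA -ht1 -ht2 scalerA -expr2 sqrCi scaleN1r opprK.
  by rewrite addrACA subrr addr0 scaler_nat mulr2n.
move=> /(congr1 ( *:%R 2^-1)); rewrite !scalerA mulVf ?pnatr_eq0// scale1r.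
by rewrite mulrC.
Qed.

End irreducible.
End schur.

(** * Classification of a power partial isometry *)

Section power_partial_isometries.
Variables (R : realType) (H : hilbertType R).
Implicit Types (A B Q X E F f g : H -> H).
Local Notation C := R[i].

(** Both f and g are contractions; for b orthogonal to the kernel of f this gives
    |g (f b) - b|^2 <= |f b|^2 - 2 |f b|^2 + |b|^2 = 0. *)
Lemma partial_isometryE f g : adj f g -> partial_isometry f ->
  forall x, f (g (f x)) = f x.
Proof.
move=> fg pf; have fl := adj_lin fg; have gl := adj_lin (adjC fg).
pose N := [set y | f y = 0].
have Ncl : closed N.
  have -> : N = orthocomplement (range g).
    apply/seteqP; split => y /=; first by move=> fy _ [z _ <-]; rewrite -fg fy inner0l.
    move=> h; apply: inner_ext => z; rewrite fg inner0l; apply: h; by exists z.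
  exact: orthocomplement_closed.
have Nl : linear_subspace N.
  by split=> [|a x y]; rewrite /N /= ?(lin0 fl)// fl => -> ->; rewrite scaler0 addr0.
have fb x : sqn (f x) <= sqn x.
  have [p [fp xp]] := closed_projection x Ncl Nl.
  have -> : f x = f (x - p) by rewrite linB// fp subr0.
  have /pf/(congr1 (fun z => z ^+ 2)) : forall y, f y = 0 -> inner (x - p) y = 0 by exact: xp.
  rewrite !norm_sqn => /complexI ->.
  have -> : sqn x = sqn (x - p) + sqn p; last by rewrite lerDl sqn_ge0.
  rewrite -{1}(subrK p x) /sqn (dnormD (@inner R H))/=.
  by rewrite (xp _ fp) conjC0 !addr0 [LHS]raddfD.
have gb y : sqn (g y) <= sqn y.
  have h := cauchy_schwarz (f (g y)) y; move: h.
  rewrite fg sqnE.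
  rewrite ger0_norm ?ler0c ?sqn_ge0// -rmorphXn/= lecR => h.
  have h2 : sqn (g y) ^+ 2 <= sqn (g y) * sqn y.
    by apply: le_trans h _; rewrite ler_wpM2r ?sqn_ge0.
  have := sqn_ge0 (g y); rewrite le_eqVlt => /orP[/eqP <-|g0]; first exact: sqn_ge0.
  by move: h2; rewrite expr2 ler_pM2l.
move=> x; have [p [fp xp]] := closed_projection x Ncl Nl.
have -> : f x = f (x - p) by rewrite linB// fp subr0.
set b := x - p in xp *; congr (f _).
apply/eqP; rewrite -subr_eq0; apply/eqP/sqn_eq0/le_anti; rewrite sqn_ge0 andbT.
have fb2 : sqn (f b) = sqn b.
  apply: complexI; rewrite -!norm_sqn; congr (_ ^+ 2); apply: pf; exact: xp.
have -> : sqn (g (f b) - b) = sqn (g (f b)) - sqn (f b) - sqn (f b) + sqn b.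
  rewrite /sqn (dnormB (@inner R H))/= -fg.
  have -> : inner (g (f b)) b = inner (f b) (f b) by rewrite (adjC fg).
  have -> : (inner (f b) (f b))^* = inner (f b) (f b) by rewrite -innerC.
  by rewrite !(raddfD, raddfN)/=; ring.
by have := gb (f b); rewrite fb2 => h; lra.
Qed.

Record ppi A B : Prop := Ppi {
  ppi_adj : adj A B ;
  ppiE : forall m x, iter m A (iter m B (iter m A x)) = iter m A x }.

Lemma power_partial_isometry_ppi (V : bounded_operator H H) :
  power_partial_isometry V -> ppi V (adjoint V).
Proof.
move=> pV; split=> [|m x]; first exact: operator_adj.
apply: partial_isometryE (pV m) x; apply: adj_iter; exact: operator_adj.
Qed.

Lemma ppiC A B : ppi A B -> ppi B A.
Proof.
move=> [AB ABA]; split=> [|m x]; first exact: adjC.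
apply: inner_ext => z; have ABm := adj_iter m AB.
by rewrite (adjC ABm) ABm (adjC ABm) ABA -(adjC ABm).
Qed.

(** The product of two projections is a contraction; if it is idempotent, the
    vectors in its range keep their norm under F, so they are fixed by F, and
    E F = F E F is self-adjoint. *)
Lemma projections_commute E F : adj E E -> adj F F ->
  (forall x, E (E x) = E x) -> (forall x, F (F x) = F x) ->
  (forall x, E (F (E (F x))) = E (F x)) -> forall x, E (F x) = F (E x).
Proof.
move=> EE FF E2 F2 EFEF.
have El := adj_lin EE; have Fl := adj_lin FF.
have FEF x : E (F x) = F (E (F x)).
  apply/eqP; rewrite -subr_eq0; apply/eqP/inner_eq0; set y := E (F x).
  rewrite innerBr -[inner _ (F y)]FF (linB _ _ Fl) F2 subrr inner0l subr0.
  rewrite innerBl FF {1}/y EE E2 -/y [X in _ - X]EE.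
  by rewrite {2}/y EFEF subrr.
move=> x; apply: inner_ext => z.
by rewrite FEF !(FF, EE) -FEF.
Qed.

Section ppi_theory.
Variables A B : H -> H.
Hypothesis AB : ppi A B.
Let adjAB := ppi_adj AB.
Let Al := adj_lin adjAB.
Let Bl := adj_lin (adjC adjAB).
Let ABA := ppiE AB.
Let BAB := ppiE (ppiC AB).

Definition initial_proj A B m x : H := iter m B (iter m A x).
Definition final_proj A B x : H := A (B x).
Local Notation E := (initial_proj A B).
Local Notation F := (final_proj A B).

Lemma initial_proj_adj m : adj (E m) (E m).
Proof. exact: (adj_comp (adj_iter m adjAB) (adjC (adj_iter m adjAB))). Qed.

Lemma final_proj_adj : adj F F.
Proof. exact: (adj_comp (adjC adjAB) adjAB). Qed.

Lemma initial_proj_initial_proj k m x : E k (E m x) = E (maxn k m) x.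
Proof.
rewrite /initial_proj; have [km|/ltnW mk] := leqP k m.
  by rewrite -(subnKC km) iterD BAB.
have kE z : iter k A z = iter (k - m) A (iter m A z) by rewrite -iterD subnK.
by rewrite !kE ABA.
Qed.

Lemma final_proj_final_proj x : F (F x) = F x.
Proof. by rewrite /final_proj; congr A; have := BAB 1 x. Qed.

(** The commutation of Halmos and Wallen: A^m A is a partial isometry along with
    A^m and A, which makes the product of the two projections idempotent. *)
Lemma initial_proj_final_proj m x : E m (F x) = F (E m x).
Proof.
move: x; apply: projections_commute => [|||x|x].
- exact: initial_proj_adj.
- exact: final_proj_adj.
- by move=> x; rewrite initial_proj_initial_proj maxnn.
- exact: final_proj_final_proj.
rewrite /initial_proj /final_proj; congr (iter m B _).
have h := ABA m.+1 (B x); rewrite -iterSr -[B (iter m B _)]/(iter m.+1 B _).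
by rewrite -[iter m A (A (B x))]iterSr h iterSr.
Qed.

(** The vectors w and A w, ..., A^(k+1) w have the same norm, so A^k w lies in the
    initial space of A. *)
Lemma initial_proj_step k w : E k.+1 w = w -> B (A (iter k A w)) = iter k A w.
Proof.
move=> w1; have w0 : E k w = w.
  by rewrite -{1}w1 initial_proj_initial_proj (maxn_idPr (leqnSn k)).
apply/esym/eqP; rewrite -subr_eq0; apply/eqP/inner_eq0; set y := iter k A w.
have AABA : A (B (A y)) = A y by have := ABA 1 y.
rewrite innerBr -[inner _ (B (A y))]adjAB (linB _ _ Al) AABA subrr inner0l subr0.
rewrite innerBl (adjC adjAB) -[A y]/(iter k.+1 A w).
rewrite (adj_iter k adjAB) (adj_iter k.+1 adjAB).
by rewrite -/(E k w) -/(E k.+1 w) w0 w1 subrr.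
Qed.

End ppi_theory.

(** The relation of V_j with the pair (V_i, its adjoint): the two phases are
    conjugate, so they cancel in every word with as many A as B. *)
Definition twisted_commute A B X (nu : C) :=
  [/\ lin X, `|nu| = 1, forall x, X (A x) = nu *: A (X x) &
      forall x, X (B x) = nu^* *: B (X x)].

Lemma twisted_iter A X nu k x : lin A -> (forall x, X (A x) = nu *: A (X x)) ->
  X (iter k A x) = nu ^+ k *: iter k A (X x).
Proof.
move=> Al XA; elim: k x => [|k IH] x; first by rewrite expr0 scale1r.
by rewrite iterS XA IH (linZ _ _ Al) scalerA exprS.
Qed.

Lemma twisted_initial_proj A B X nu m x : adj A B -> twisted_commute A B X nu ->
  X (initial_proj A B m x) = initial_proj A B m (X x).
Proof.
move=> AB [Xl n1 XA XB]; rewrite /initial_proj.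
rewrite (twisted_iter _ _ (adj_lin (adjC AB)) XB) (twisted_iter _ _ (adj_lin AB) XA).
rewrite (linZ _ _ (adj_lin (adj_iter m (adjC AB)))) scalerA -exprMn.
by rewrite [_^* * _]mulrC -normCK n1 !expr1n scale1r.
Qed.

Lemma twisted_final_proj A B X nu x : adj A B -> twisted_commute A B X nu ->
  X (final_proj A B x) = final_proj A B (X x).
Proof.
move=> AB [Xl n1 XA XB]; rewrite /final_proj XA XB (linZ _ _ (adj_lin AB)) scalerA.
by rewrite -normCK n1 expr1n scale1r.
Qed.

(** None stands for the infinite length. *)
Definition below (q : option nat) k := if q is Some p then (k < p)%N else true.

(** A ladder of length q: the space is the orthogonal sum of the images A^k W,
    k < q, of the space W of the vectors fixed by the projection Q; A carries
    each rung isometrically to the next and kills the last one. The totality of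
    the rungs is stated through Q (B^k z), the component of z on the k-th rung
    brought back to W. The projection Q will be a polynomial in A and B in which
    the phases cancel, whence [lad_comm]. *)
Record ladder A B Q (q : option nat) : Prop := Ladder {
  lad_adj : adj A B ;
  lad_Qadj : adj Q Q ;
  lad_QQ : forall x, Q (Q x) = Q x ;
  lad_BQ : forall x, B (Q x) = 0 ;
  lad_step : forall k x, below q k.+1 -> B (A (iter k A (Q x))) = iter k A (Q x) ;
  lad_top : forall p, q = Some p -> forall x, iter p A (Q x) = 0 ;
  lad_total : forall z, (forall k, Q (iter k B z) = 0) -> z = 0 ;
  lad_comm : forall X nu, twisted_commute A B X nu -> forall x, X (Q x) = Q (X x) }.

Lemma ladder_lin A B Q q : ladder A B Q q -> lin A.
Proof. by move=> lad; exact: adj_lin (lad_adj lad). Qed.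

Lemma below_le q i j : (i <= j)%N -> below q j -> below q i.
Proof. by rewrite /below; case: q => // p; exact: leq_ltn_trans. Qed.

Lemma lad_iso A B Q q k x : ladder A B Q q -> below q k -> initial_proj A B k (Q x) = Q x.
Proof.
move=> lad; elim: k => [//|k IH] kq; rewrite /initial_proj iterSr /= (lad_step lad)//.
exact: IH (below_le (leqnSn k) kq).
Qed.

Section classification.
Variables A B : H -> H.
Hypothesis AB : ppi A B.
Hypothesis total : forall G : set H,
  (forall X nu, twisted_commute A B X nu -> forall x, G x -> G (X x)) ->
  (forall x, G x -> G (A x)) -> (forall x, G x -> G (B x)) ->
  (exists2 g, G g & g != 0) -> forall z, orthocomplement G z -> z = 0.
Let adjAB := ppi_adj AB.
Let Al := adj_lin adjAB.
Let Bl := adj_lin (adjC adjAB).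
Local Notation E := (initial_proj A B).
Local Notation F := (final_proj A B).

(** The projection onto the vectors of the kernel of B on which A^m is isometric
    and A^(m+1) vanishes: the first rungs of the truncated shifts of size
    m + 1. *)
Definition step_proj m x : H := E m (x - F x) - E m.+1 (x - F x).

Let El m := adj_lin (initial_proj_adj AB m).
Let Fl := adj_lin (final_proj_adj AB).

Lemma step_projE m x : step_proj m x = (E m x - E m.+1 x) - F (E m x - E m.+1 x).
Proof.
rewrite /step_proj !(linB _ _ (El _)) (linB _ _ Fl) !(initial_proj_final_proj AB).
by rewrite !opprB addrACA [RHS]addrACA; congr (_ + _); rewrite addrC.
Qed.

Lemma step_proj_adj m : adj (step_proj m) (step_proj m).
Proof.
move=> x y; rewrite (step_projE m y).
have a1 := adjB (@adj_id _ H) (final_proj_adj AB).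
have a2 := adjB (initial_proj_adj AB m) (initial_proj_adj AB m.+1).
exact: (adj_comp a1 a2).
Qed.

Lemma initial_proj_step_proj k m x : (k <= m)%N -> E k (step_proj m x) = step_proj m x.
Proof.
move=> km; rewrite /step_proj (linB _ _ (El _)) !(initial_proj_initial_proj AB).
by rewrite (maxn_idPr km) (maxn_idPr (leqW km)).
Qed.

Lemma B_step_proj m x : B (step_proj m x) = 0.
Proof.
rewrite step_projE (linB _ _ Bl) /final_proj.
by have := ppiE (ppiC AB) 1 (E m x - E m.+1 x) => /= ->; rewrite subrr.
Qed.

Lemma step_proj_top m x : iter m.+1 A (step_proj m x) = 0.
Proof.
rewrite /step_proj (linB _ _ (adj_lin (adj_iter m.+1 adjAB))).
by rewrite [X in _ - X](ppiE AB m.+1) iterS (ppiE AB m) -iterS subrr.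
Qed.

Lemma step_proj_idem m x : step_proj m (step_proj m x) = step_proj m x.
Proof.
have F0 : F (step_proj m x) = 0 by rewrite /final_proj B_step_proj (lin0 Al).
rewrite [LHS]/step_proj F0 subr0 initial_proj_step_proj//.
have -> : E m.+1 (step_proj m x) = 0.
  by rewrite /initial_proj step_proj_top (lin0 (adj_lin (adjC (adj_iter m.+1 adjAB)))).
by rewrite subr0.
Qed.

Lemma step_proj_comm m X nu : twisted_commute A B X nu ->
  forall x, X (step_proj m x) = step_proj m (X x).
Proof.
move=> Xc x; have [Xl _ _ _] := Xc.
by rewrite /step_proj (linB _ _ Xl) !(twisted_initial_proj _ _ adjAB Xc) (linB _ _ Xl)
  (twisted_final_proj _ adjAB Xc).
Qed.

Definition rungs (W : set H) := [set x | exists c k w, W w /\ x = c *: iter k A w].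

(** The rungs over a subspace W of the kernel of B are stable under A, B and all
    that commutes with them up to a phase, hence total. *)
Lemma rungs_total (W : set H) :
  (forall X nu, twisted_commute A B X nu -> forall w, W w -> W (X w)) ->
  (forall w, W w -> B w = 0) ->
  (forall w k, W w -> E k.+1 w = w \/ iter k.+1 A w = 0) ->
  (exists2 w, W w & w != 0) -> forall z, orthocomplement (rungs W) z -> z = 0.
Proof.
move=> WX WB Wstep [w0 Ww0 w00]; apply: total => [X nu Xc|||].
- move=> _ [c [k [w [Ww ->]]]]; have [Xl _ XA _] := Xc.
  exists (c * nu ^+ k), k, (X w); split; first exact: WX Xc _ Ww.
  by rewrite (linZ _ _ Xl) (twisted_iter _ _ Al XA) scalerA.
- move=> _ [c [k [w [Ww ->]]]]; exists c, k.+1, w; split => //.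
  by rewrite (linZ _ _ Al).
- move=> _ [c [[|k] [w [Ww ->]]]]; rewrite (linZ _ _ Bl).
    by exists 0, 0%N, w; rewrite /= WB// scaler0 scale0r.
  have [h|h] := Wstep w k Ww.
    by exists c, k, w; rewrite iterS (initial_proj_step AB).
  by exists 0, 0%N, w; rewrite h (lin0 Bl) scaler0 scale0r.
- by exists w0 => //; exists 1, 0%N, w0; rewrite scale1r.
Qed.

Lemma finite_ladder m : (exists x, step_proj m x != 0) ->
  ladder A B (step_proj m) (Some m.+1).
Proof.
move=> [x0 x00]; split.
- exact: adjAB.
- exact: step_proj_adj.
- exact: step_proj_idem.
- exact: B_step_proj.
- move=> k x; rewrite /below ltnS => km; apply: (initial_proj_step AB).
  exact: initial_proj_step_proj.
- by move=> p [<-]; exact: step_proj_top.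
- move=> z hz; apply: (@rungs_total (range (step_proj m))).
  + move=> X nu Xc _ [w _ <-]; rewrite (step_proj_comm _ Xc).
    by exists (X w).
  + by move=> _ [w _ <-]; exact: B_step_proj.
  + move=> _ k [w _ <-]; have [km|mk] := ltnP k m.
      by left; exact: initial_proj_step_proj.
    right; rewrite -(subnK mk) -addnS iterD step_proj_top.
    exact: lin0 (adj_lin (adj_iter _ adjAB)).
  + by exists (step_proj m x0) => //; exists x0.
  move=> _ [c [k [_ [[w _ <-] ->]]]].
  by rewrite innerZr -(adj_iter k (adjC adjAB)) -step_proj_adj hz inner0l mulr0.
- by move=> X nu Xc; exact: step_proj_comm Xc.
Qed.

(** If no truncated shift occurs, the initial projections of all powers agree on
    the kernel of B, so that A is isometric on the rungs over this kernel; as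
    they are total, A is an isometry. *)
Lemma infinite_ladder : (forall m x, step_proj m x = 0) ->
  (exists2 x, x != 0 & B x = 0) -> ladder A B (fun x => x - F x) None.
Proof.
move=> step0 [x0 x00 Bx0].
pose W := [set x | B x = 0 /\ forall m, E m x = x].
have kerW x : B x = 0 -> W x.
  move=> Bx; split=> //; elim=> [//|m IH].
  have := step0 m x; rewrite /step_proj /final_proj Bx (lin0 Al) subr0 IH.
  by move=> /eqP; rewrite subr_eq0 => /eqP.
have Wtot : forall z, orthocomplement (rungs W) z -> z = 0.
  apply: rungs_total.
  - move=> X nu Xc w [Bw Ew]; split=> [|m].
      have [Xl n1 _ XB] := Xc; have := XB w; rewrite Bw (lin0 Xl).
      move=> /esym/(congr1 ( *:%R nu)); rewrite scalerA -normCK n1 expr1n scale1r.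
      by rewrite scaler0.
    by rewrite -(twisted_initial_proj _ _ adjAB Xc) Ew.
  - by move=> w [].
  - by move=> w k [_ ->]; left.
  - by exists x0 => //; exact: kerW.
have BA x : B (A x) = x.
  apply/eqP; rewrite -subr_eq0; apply/eqP/Wtot => _ [c [k [w [[_ Ew] ->]]]].
  rewrite innerZr innerBl (adjC adjAB) adjAB.
  by rewrite (initial_proj_step AB) ?Ew// subrr mulr0.
have FF : adj (fun x => x - F x) (fun x => x - F x).
  exact: (adjB (@adj_id _ H) (final_proj_adj AB)).
have BF x : B (x - F x) = 0 by rewrite (linB _ _ Bl) /final_proj BA subrr.
split=> //.
- by move=> x; rewrite [F (_ - _)]/final_proj BF (lin0 Al) subr0.
- move=> z hz; apply: Wtot => _ [c [k [w [[Bw _] ->]]]].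
  have -> : w = w - F w by rewrite /final_proj Bw (lin0 Al) subr0.
  by rewrite innerZr -(adj_iter k (adjC adjAB)) -FF hz inner0l mulr0.
- move=> X nu Xc x; have [Xl _ _ _] := Xc.
  by rewrite (linB _ _ Xl) (twisted_final_proj _ adjAB Xc).
Qed.

(** The third case is that of a trivial kernel of B, since B annihilates
    x - A (B x). *)
Lemma one_sided_classification :
  [\/ exists p Q, (0 < p)%N /\ ladder A B Q (Some p),
      exists Q, ladder A B Q None | forall x, A (B x) = x].
Proof.
have [[m [x hx]]|step0] := pselect (exists m, exists x, step_proj m x != 0).
  by apply: Or31; exists m.+1, (step_proj m); split => //; apply: finite_ladder; exists x.
have {}step0 m x : step_proj m x = 0.
  by apply/eqP; apply: contra_notT step0 => ?; exists m, x.
have [kerB|kerB] := pselect (exists2 x, x != 0 & B x = 0).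
  by apply: Or32; eexists; exact: infinite_ladder.
apply: Or33 => x; apply/esym/eqP; rewrite -subr_eq0.
apply: contra_notT kerB => h; exists (x - A (B x)) => //.
by rewrite (linB _ _ Bl); have /= -> := ppiE (ppiC AB) 1 x; rewrite subrr.
Qed.

End classification.

Lemma twisted_commuteC A B X nu : twisted_commute A B X nu -> twisted_commute B A X nu^*.
Proof. by case=> Xl n1 XA XB; split; rewrite ?norm_conjC// => x; rewrite conjCK. Qed.

(** The four types of Halmos and Wallen: truncated shift, shift, backward shift,
    unitary. When A is onto, the one-sided classification is applied to B; a
    truncated shift is then excluded because B is injective. *)
Theorem ppi_classification A B : ppi A B -> (exists x : H, x != 0) ->
  (forall G : set H,
    (forall X nu, twisted_commute A B X nu -> forall x, G x -> G (X x)) ->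
    (forall x, G x -> G (A x)) -> (forall x, G x -> G (B x)) ->
    (exists2 g, G g & g != 0) -> forall z, orthocomplement G z -> z = 0) ->
  [\/ exists p Q, (0 < p)%N /\ ladder A B Q (Some p),
      exists Q, ladder A B Q None, exists Q, ladder B A Q None |
      (forall x, A (B x) = x) /\ (forall x, B (A x) = x)].
Proof.
move=> AB [x0 x00] total.
have [h|h|A1] := one_sided_classification AB total.
- exact: Or41.
- exact: Or42.
have total' (G : set H) :
  (forall X nu, twisted_commute B A X nu -> forall x, G x -> G (X x)) ->
  (forall x, G x -> G (B x)) -> (forall x, G x -> G (A x)) ->
  (exists2 g, G g & g != 0) -> forall z, orthocomplement G z -> z = 0.
  move=> GX GB GA; apply: total => // X nu /twisted_commuteC; exact: GX.
have [[p [Q [_ lad]]]|h|B1] := one_sided_classification (ppiC AB) total'.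
- have iterAB m x : iter m A (iter m B x) = x.
    by elim: m x => // m IH x; rewrite iterSr -[iter m.+1 B x]/(B _) A1 IH.
  have Q0 x : Q x = 0.
    rewrite -[Q x](iterAB p) (lad_top lad)//.
    exact: lin0 (adj_lin (adj_iter p (ppi_adj AB))).
  by have := lad_total lad (fun k => Q0 (iter k A x0)) => x0E; rewrite x0E eqxx in x00.
- exact: Or43.
- exact: Or44.
Qed.

End power_partial_isometries.

(** * Square summable sequences and synthesis operators *)

Section l2_vectors.
Variables (R : realType) (I : choiceType).
Local Notation C := R[i].
Implicit Types a b : l2 R I.

Lemma l2_ext a b : (forall k, a k = b k) -> a = b.
Proof. by move=> ab; apply/val_inj/funext. Qed.

Lemma l2_innerE a b : inner a b = csum (fun k => a k * (b k)^*).
Proof. by []. Qed.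

Lemma l2_sqn_le a (M : R) :
  (forall A : {fset I}, \sum_(k <- A) `|a k| ^+ 2 <= M%:C%C) -> sqn a <= M.
Proof. by move=> aM; rewrite -lecR -sqnE; have [_ _] := l2_dot_ge0 a; apply. Qed.

Lemma l2_basis_summable (k : I) :
  (fun i => (i == k)%:R : C) \in @square_summable R I.
Proof.
apply/asboolP; exists 1 => A; rewrite (eq_bigr (fun i => (i == k)%:R)); last first.
  by move=> i _; case: eqP; rewrite ?normr1 ?normr0 ?expr1n ?expr0n.
have [kA|kA] := boolP (k \in A).
  by rewrite (big_fsetD1 k kA)/= eqxx big_seq big1 ?addr0// => i /fsetD1P[/negPf->].
by rewrite big_seq big1// => i iA; case: eqP => // ik; rewrite -ik iA in kA.
Qed.

Definition l2_basis k : l2 R I := L2 (l2_basis_summable k).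

Lemma l2_basisE k i : l2_basis k i = (i == k)%:R.
Proof. by []. Qed.

(** The net of partial sums is constant above the singleton of k. *)
Lemma inner_basis a k : inner a (l2_basis k) = a k.
Proof.
rewrite l2_innerE; apply: csum_unique.
have FF := @summability.totally_filter I.
apply: cvg_near_cst; exists [fset k]%fset => // A /=; rewrite fsub1set => kA.
rewrite (big_fsetD1 k kA)/= eqxx conjC1 mulr1 big_seq big1 ?addr0//.
by move=> i /fsetD1P[/negPf ik _]; rewrite ik conjC0 mulr0.
Qed.

Lemma basis_inner a k : inner (l2_basis k) a = (a k)^*.
Proof. by rewrite innerC inner_basis. Qed.

Lemma l2_diag_adj (pos : I -> nat) (nu : C) : `|nu| = 1 ->
  adj (l2_diag pos nu^*) (l2_diag pos nu).
Proof.
move=> n1 a b; rewrite !l2_innerE; congr csum; apply/funext => k.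
rewrite !l2_diagE ?norm_conjC// rmorphM rmorphXn/=.
by rewrite mulrA [_ * a k]mulrC.
Qed.

End l2_vectors.

Section shifts.
Variable R : realType.
Local Notation C := R[i].

(** Deleting coordinates and relabelling the others injectively does not increase
    the norm. *)
Lemma l2_reindex_le (I K : choiceType) (x : l2 R K) (P : pred I) (g : I -> K)
    (A : {fset I}) : {in P &, injective g} ->
  \sum_(k <- A) `|if P k then x (g k) else 0| ^+ 2 <= (sqn x)%:C%C.
Proof.
move=> gi; rewrite -sqnE; have [_ h _] := l2_dot_ge0 x.
apply: le_trans (h [fset g m | m in A & P m]%fset).
rewrite big_imfset/=; last first.
  by move=> i j /andP[_ Pi] /andP[_ Pj]; exact: gi.
rewrite big_filter [leLHS](bigID P)/= [X in _ + X]big1 ?addr0.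
  by apply: ler_sum => k ->.
by move=> k /negPf ->; rewrite normr0 expr0n.
Qed.

Lemma shift_adj : adj (@Defs.shift R) (adjoint (@Defs.shift R)).
Proof.
apply: (@bounded_adj _ _ _ _ 1) => [a x y|x].
  apply: l2_ext => k; rewrite shiftE.
  have -> : (a *: Defs.shift x + Defs.shift y) k = a * Defs.shift x k + Defs.shift y k by [].
  by rewrite !shiftE; case: k => [|k] //; rewrite mulr0 addr0.
rewrite mul1r; apply: l2_sqn_le => A.
have := @l2_reindex_le nat nat x (fun k => k != 0%N) predn A.
rewrite (eq_bigr (fun k => `|Defs.shift x k| ^+ 2)) => [|k _]; last first.
  by rewrite shiftE; case: k.
by apply => -[|i] [|j] // _ _ /= ->.
Qed.

Lemma shift_basis k : Defs.shift (l2_basis R k) = l2_basis R k.+1.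
Proof.
by apply: l2_ext => -[|m]; rewrite shiftE l2_basisE ?eqSS.
Qed.

Lemma adjoint_shiftE x k : adjoint (@Defs.shift R) x k = x k.+1.
Proof. by rewrite -inner_basis (adjC shift_adj) shift_basis inner_basis. Qed.

Lemma truncated_shift_adj p :
  adj (@truncated_shift R p) (adjoint (@truncated_shift R p)).
Proof.
apply: (@bounded_adj _ _ _ _ 1) => [a x y|x].
  apply: l2_ext => k; rewrite truncated_shiftE.
  have -> : (a *: truncated_shift x + truncated_shift y) k =
    a * truncated_shift x k + truncated_shift y k by [].
  by rewrite !truncated_shiftE; case: ifP => // _; rewrite mulr0 addr0.
rewrite mul1r; apply: l2_sqn_le => A.
have := @l2_reindex_le 'I_p 'I_p x (fun k => k != 0 :> nat) (@ord_pred p) A.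
rewrite (eq_bigr (fun k => `|truncated_shift x k| ^+ 2)) => [|k _]; last first.
  by rewrite truncated_shiftE; case: eqP.
by apply => i j _ _; exact: ord_pred_inj.
Qed.

Lemma val_ord_pred p (i : 'I_p) : i != 0 :> nat -> ord_pred i = i.-1 :> nat.
Proof.
rewrite -lt0n => i0; rewrite /= -{1}(prednK i0) addSn /= modnDr modn_small//.
exact: leq_ltn_trans (leq_pred _) (ltn_ord i).
Qed.

Lemma adjoint_truncated_shiftE p (x : l2 R 'I_p) k :
  adjoint (@truncated_shift R p) x k =
  if insub k.+1 is Some j then x j else 0.
Proof.
rewrite -inner_basis (adjC (@truncated_shift_adj p)).
have -> : truncated_shift (l2_basis R k) =
    if insub k.+1 is Some j then l2_basis R j else 0.
  apply: l2_ext => i; rewrite truncated_shiftE l2_basisE.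
  case: insubP => [j _ jk|kp].
    have -> : l2_basis R j i = (i == k.+1 :> nat)%:R by rewrite -jk.
    have -> : (ord_pred i == k) = (ord_pred i == k :> nat) by [].
    case: ifPn => [/eqP-> //|i0].
    by rewrite val_ord_pred// -eqSS prednK// lt0n.
  have -> : (0 : l2 R 'I_p) i = 0 by [].
  case: ifPn => // i0; have -> : (ord_pred i == k) = (ord_pred i == k :> nat) by [].
  rewrite val_ord_pred//; case: eqP => // ik.
  by rewrite -ik prednK ?lt0n// ltn_ord in kp.
by case: insubP => [j _ _|_]; rewrite ?inner_basis ?inner0r.
Qed.

End shifts.

Section synthesis.
Variables (R : realType) (H : hilbertType R) (I : choiceType) (T : I -> H -> H).
Local Notation C := R[i].

Definition analysis w z : l2 R I := l2_of (fun k => inner z (T k w)).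
(** The sum over k of a_k T_k w, for an orthogonal family of vectors T_k w of norm
    |w|. As the adjoint of the analysis operator it needs no convergence
    argument beyond the Riesz theorem. *)
Definition synth (a : l2 R I) w : H := adjoint (analysis w) a.

Definition orthogonal_system (L : set H) := forall w w' k l, L w -> L w' ->
  inner (T k w) (T l w') = (k == l)%:R * inner w w'.

Variable L : set H.
Hypothesis TL : orthogonal_system L.

(** With u the partial sum of the Fourier series of z, and S the left-hand side,
    Cauchy-Schwarz reads S^2 <= |z|^2 (S |w|^2). *)
Lemma bessel w z (A : {fset I}) : L w ->
  \sum_(k <- A) `|inner z (T k w)| ^+ 2 <= (sqn w * sqn z)%:C%C.
Proof.
move=> Lw; set S := \sum_(k <- A) _.
pose u := \sum_(k <- A) inner z (T k w) *: T k w.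
have S0 : 0 <= S by apply: sumr_ge0 => k _; rewrite exprn_ge0.
have zu : inner z u = S.
  rewrite linear_sumr/=; apply: eq_bigr => k _.
  by rewrite innerZr normCK mulrC.
have uT k : k \in A -> inner u (T k w) = inner z (T k w) * inner w w.
  move=> kA; rewrite linear_sumlz/= (big_fsetD1 k kA)/= innerZl TL// eqxx mul1r.
  rewrite big_seq big1 ?addr0// => l /fsetD1P[/negPf lk _].
  by rewrite innerZl TL// lk mul0r mulr0.
have uu : inner u u = S * inner w w.
  rewrite {2}/u linear_sumr/= mulr_suml !big_seq; apply: eq_bigr => k kA.
  by rewrite innerZr uT// normCK mulrCA mulrA.
have := cauchy_schwarz z u; rewrite zu ger0_norm//.
have [s SE] : exists s : R, S = s%:C%C.
  by exists (complex.Re S); rewrite RRe_real// ger0_real.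
move: S0 uu; rewrite SE !sqnE -rmorphM/= -rmorphXn/= ler0c !lecR => s0 /complexI -> h.
move: s0; rewrite le_eqVlt => /orP[/eqP <-|s0]; first by rewrite mulr_ge0 ?sqn_ge0.
rewrite -(ler_pM2l s0) -expr2; apply: le_trans h _.
by rewrite mulrCA [sqn z * _]mulrC.
Qed.

Lemma analysisE w z k : L w -> analysis w z k = inner z (T k w).
Proof.
move=> Lw; rewrite /analysis l2_ofE//; apply/asboolP.
by exists (sqn w * sqn z)%:C%C => A; exact: bessel.
Qed.

Lemma analysis_adj w : L w -> adj (analysis w) (synth^~ w).
Proof.
move=> Lw; apply: (@bounded_adj _ _ _ _ (sqn w)) => [a x y|x].
  apply: l2_ext => k; have -> : (a *: analysis w x + analysis w y) k =
    a * analysis w x k + analysis w y k by [].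
  by rewrite !analysisE// innerDl innerZl.
apply: l2_sqn_le => A; under eq_bigr do rewrite analysisE//.
exact: bessel.
Qed.

Lemma synth_lin w : L w -> lin (synth^~ w).
Proof. by move=> Lw; exact: adj_lin (adjC (analysis_adj Lw)). Qed.

Lemma analysis_synth w w' a : L w -> L w' -> analysis w' (synth a w) = inner w w' *: a.
Proof.
move=> Lw Lw'; apply: l2_ext => k; rewrite analysisE//.
have -> : (inner w w' *: a) k = inner w w' * a k by [].
rewrite innerC -(analysis_adj Lw).
have -> : analysis w (T k w') = inner w' w *: l2_basis R k.
  apply: l2_ext => l; rewrite analysisE// TL//.
  have -> : (inner w' w *: l2_basis R k) l = inner w' w * l2_basis R k l by [].
  by rewrite l2_basisE mulrC eq_sym.
by rewrite innerZl basis_inner rmorphM/= conjCK -innerC.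
Qed.

(** Synthesis embeds the tensor product of l2 with L isometrically. *)
Lemma inner_synth w w' a b : L w -> L w' ->
  inner (synth a w) (synth b w') = inner a b * inner w w'.
Proof.
move=> Lw Lw'; rewrite -(analysis_adj Lw') analysis_synth//.
by rewrite innerZl mulrC.
Qed.

Lemma synth_basis w k : L w -> synth (l2_basis R k) w = T k w.
Proof.
move=> Lw; apply: inner_extr => z.
by rewrite -(analysis_adj Lw) inner_basis analysisE.
Qed.

(** Intertwining is tested on the analysis side, coordinate by coordinate. *)
Lemma synth_intertwine (X X' : H -> H) (f g : l2 R I -> l2 R I) w w' a :
  adj X X' -> adj g f -> L w -> L w' ->
  (forall z, analysis w (X' z) = g (analysis w' z)) ->
  X (synth a w) = synth (f a) w'.
Proof.
move=> XX' gf Lw Lw' h; apply: inner_extr => z.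
by rewrite -(adjC XX') -(analysis_adj Lw) -(analysis_adj Lw') h gf.
Qed.

Lemma synth_diag (X X' : H -> H) (pos : I -> nat) (nu : C) w a :
  adj X X' -> `|nu| = 1 -> L w -> L (X w) ->
  (forall k, X (T k w) = nu ^+ pos k *: T k (X w)) ->
  X (synth a w) = synth (l2_diag pos nu a) (X w).
Proof.
move=> XX' n1 Lw LXw XT; apply: (synth_intertwine _ XX' (l2_diag_adj pos n1) Lw LXw) => z.
apply: l2_ext => k; rewrite l2_diagE ?norm_conjC// !analysisE//.
by rewrite (adjC XX') XT innerZr rmorphXn.
Qed.

Lemma synth_comm (X X' : H -> H) w a : adj X X' -> L w -> L (X w) ->
  (forall k, X (T k w) = T k (X w)) -> X (synth a w) = synth a (X w).
Proof.
move=> XX' Lw LXw XT; apply: (synth_intertwine a XX' (@adj_id _ _)) => // z.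
by apply: l2_ext => k; rewrite !analysisE// (adjC XX') XT.
Qed.

End synthesis.

(** * Synthesis along a ladder *)

Section ladder_synthesis.
Variables (R : realType) (H : hilbertType R).
Local Notation C := R[i].

Definition part_length (k : part) : option nat :=
  if k is Phi_ p then Some p else None.

Definition part_synth (k : part) (A : H -> H) : Defs.factor R k -> H -> H :=
  match k return Defs.factor R k -> H -> H with
  | Phi_ p => synth (fun m : 'I_p => iter m A)
  | _ => synth (fun m : nat => iter m A)
  end.

Definition forward_action (k : part) : Defs.factor R k -> Defs.factor R k :=
  match k with
  | Phi_ p => @truncated_shift R p
  | _ => @Defs.shift R
  end.

(** Moving the common power A^k across leaves A^(l-k), whose adjoint kills the
    first rung. *)
Lemma ladder_orthogonal (A B Q : H -> H) q k l w w' : ladder A B Q q ->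
  below q k -> below q l -> Q w = w -> Q w' = w' ->
  inner (iter k A w) (iter l A w') = (k == l)%:R * inner w w'.
Proof.
move=> lad; have AB := lad_adj lad.
have key i d u v : below q (i + d) -> Q u = u -> Q v = v ->
    inner (iter i A u) (iter (i + d) A v) = (d == 0)%:R * inner u v.
  move=> iq uQ vQ; rewrite iterD -(adj_iter i (adjC AB)).
  rewrite -/(initial_proj A B i u) -[u in initial_proj _ _ _ u]uQ (lad_iso _ lad); last first.
    exact: below_le (leq_addr _ _) iq.
  case: d {iq} => [|d]; first by rewrite mul1r uQ.
  by rewrite iterS -(adjC AB) (lad_BQ lad) inner0l mul0r.
move=> kq lq wQ w'Q; have [kl|/ltnW lk] := leqP k l.
  by rewrite -{1}(subnKC kl) key ?subnKC// subn_eq0 eqn_leq kl.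
rewrite innerC -{1}(subnKC lk) key ?subnKC// rmorphM/= -innerC conjC_nat.
by rewrite subn_eq0 eqn_leq lk andbT.
Qed.

Section part_ladder.
Variables (k : part) (A B Q : H -> H).
Hypothesis lad : ladder A B Q (part_length k).
Let L := [set w | Q w = w].
Let AB := lad_adj lad.
Let Al := ladder_lin lad.

Lemma nat_orthogonal_system : part_length k = None ->
  orthogonal_system (fun m : nat => iter m A) L.
Proof.
move=> kN w w' i j wL w'L.
by apply: (ladder_orthogonal lad) => //; rewrite kN.
Qed.

Lemma ord_orthogonal_system p : part_length k = Some p ->
  orthogonal_system (fun m : 'I_p => iter m A) L.
Proof.
move=> kp w w' i j wL w'L; rewrite -(inj_eq val_inj).
by apply: (ladder_orthogonal lad) => //; rewrite kp /= ltn_ord.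
Qed.

End part_ladder.

Lemma inner_part_synth k (A B Q : H -> H) a b w w' :
  ladder A B Q (part_length k) -> Q w = w -> Q w' = w' ->
  inner (@part_synth k A a w) (part_synth A b w') = inner a b * inner w w'.
Proof.
move=> lad wQ w'Q.
have sysN := nat_orthogonal_system lad; have sysO := ord_orthogonal_system lad.
case: k a b lad sysN sysO => [||p|] a b lad sysN sysO;
  by [exact: (inner_synth (sysN erefl))|exact: (inner_synth (sysO _ erefl))].
Qed.

Lemma part_synth_diag k (A B Q X X' : H -> H) nu a w :
  ladder A B Q (part_length k) -> Q w = w -> adj X X' -> twisted_commute A B X nu ->
  X (@part_synth k A a w) = part_synth A (diag_action nu a) (X w).
Proof.
move=> lad wQ XX' tc; have [_ n1 XA _] := tc.
have XwQ : Q (X w) = X w by rewrite -(lad_comm lad tc) wQ.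
have XT m : X (iter m A w) = nu ^+ m *: iter m A (X w).
  exact: twisted_iter (ladder_lin lad) XA.
have sysN := nat_orthogonal_system lad; have sysO := ord_orthogonal_system lad.
case: k a lad sysN sysO => [||p|] a lad sysN sysO;
  by [exact: (synth_diag (sysN erefl) _ XX')|exact: (synth_diag (sysO _ erefl) _ XX')].
Qed.

Lemma part_synth_comm k (A B Q X X' : H -> H) a w :
  ladder A B Q (part_length k) -> Q w = w -> adj X X' -> Q (X w) = X w ->
  (forall z, X (A z) = A (X z)) ->
  X (@part_synth k A a w) = part_synth A a (X w).
Proof.
move=> lad wQ XX' XwQ XA.
have XT m : X (iter m A w) = iter m A (X w).
  by elim: m => // m IH; rewrite !iterS XA IH.
have sysN := nat_orthogonal_system lad; have sysO := ord_orthogonal_system lad.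
case: k a lad sysN sysO => [||p|] a lad sysN sysO;
  by [exact: (synth_comm (sysN erefl) _ XX')|exact: (synth_comm (sysO _ erefl) _ XX')].
Qed.

Lemma part_synth_forward k (A B Q : H -> H) a w :
  ladder A B Q (part_length k) -> Q w = w ->
  A (@part_synth k A a w) = part_synth A (forward_action a) w.
Proof.
move=> lad wQ; have AB := lad_adj lad.
have key (lad' : ladder A B Q None) (b : l2 R nat) :
    A (synth (fun m : nat => iter m A) b w) =
    synth (fun m : nat => iter m A) (Defs.shift b) w.
  have sys := nat_orthogonal_system (k := Phi_s) lad' erefl.
  apply: (synth_intertwine sys _ AB (adjC (@shift_adj R))) => // z.
  apply: l2_ext => m; rewrite adjoint_shiftE !(analysisE sys)//.
  by rewrite (adjC AB).
case: k a lad => [||p|] a lad; try exact: key.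
have sys := ord_orthogonal_system lad erefl.
apply: (synth_intertwine sys _ AB (adjC (@truncated_shift_adj R p))) => // z.
apply: l2_ext => m; rewrite adjoint_truncated_shiftE !(analysisE sys)// (adjC AB) -iterS.
case: insubP => [j _ jm|]; first by rewrite (analysisE sys)// -jm.
rewrite -leqNgt => pm; have mp : m.+1 = p by apply/eqP; rewrite eqn_leq ltn_ord.
by rewrite mp -[w]wQ (lad_top lad)// inner0r.
Qed.

Lemma part_synth_backward (A B Q : H -> H) (a : l2 R nat) w :
  ladder A B Q None -> Q w = w ->
  B (synth (fun m : nat => iter m A) a w) =
  synth (fun m : nat => iter m A) (adjoint (@Defs.shift R) a) w.
Proof.
move=> lad wQ; have AB := lad_adj lad.
have sys := nat_orthogonal_system (k := Phi_s) lad erefl.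
apply: (synth_intertwine sys _ (adjC AB) (@shift_adj R)) => // z.
apply: l2_ext => m; rewrite shiftE (analysisE sys)// AB.
case: m => [|m]; first by rewrite /= -[w]wQ (lad_BQ lad) inner0r.
by rewrite (analysisE sys)// iterS -[w in LHS]wQ (lad_step lad)// wQ.
Qed.

End ladder_synthesis.

(** * Orthocomplements as Hilbert spaces *)

Section orthocomplement_type.
Variables (R : realType) (H : hilbertType R) (G : set H).
Local Notation C := R[i].

Definition orth_pred : {pred H} := [pred x | `[< orthocomplement G x >]].

Lemma orth_pred_submod : submod_closed orth_pred.
Proof.
have [G0 Glin] := orthocomplement_linear G.
split; first exact/asboolP.
by move=> a x y /asboolP Gx /asboolP Gy; apply/asboolP; exact: Glin.
Qed.

HB.instance Definition _ := GRing.isSubmodClosed.Build C H orth_pred orth_pred_submod.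

(** The closed subspace H_u is obtained in this form, for which closedness and
    linearity come without hypotheses on G. *)
Record osub := Osub { oval :> H ; ovalP : oval \in orth_pred }.

HB.instance Definition _ := [isSub of osub for oval].
HB.instance Definition _ := [Choice of osub by <:].
HB.instance Definition _ := [SubChoice_isSubLmodule of osub by <:].

Implicit Types x y : osub.

Definition osub_dot x y : C := inner (oval x) (oval y).

Lemma osub_bilinear : bilinear_for ( *%R : C -> C -> C) (@Num.conj C \; *%R) osub_dot.
Proof.
by split=> [y|x] a u v; rewrite /osub_dot/= ?innerDl ?innerZl ?innerDr ?innerZr.
Qed.

Lemma osub_hermitian x y : osub_dot x y = (-1) ^+ false * (osub_dot y x)^*.
Proof. by rewrite expr0 mul1r /osub_dot -innerC. Qed.

Lemma osub_pos x : x != 0 -> 0 < osub_dot x x.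
Proof. by move=> x0; rewrite /osub_dot (dnorm_gt0 (@inner R H)). Qed.

HB.instance Definition _ := bilinear_isBilinear.Build C osub osub C _ _ osub_dot osub_bilinear.
HB.instance Definition _ := isHermitianSesquilinear.Build C osub
  false (@Num.conj C) osub_dot osub_hermitian.
HB.instance Definition _ := isDotProduct.Build C osub osub_dot osub_pos.

Let form : {dot osub for @Num.conj C} := osub_dot.

Definition osub_norm x : C := `|oval x|.

Lemma osub_normD x y : osub_norm (x + y) <= osub_norm x + osub_norm y.
Proof. exact: ler_normD. Qed.

Lemma osub_normZ (a : C) x : osub_norm (a *: x) = `|a| * osub_norm x.
Proof. exact: normrZ. Qed.

Lemma osub_norm0_eq0 x : osub_norm x = 0 -> x = 0.
Proof. by move=> /eqP; rewrite normr_eq0 => /eqP x0; exact: val_inj. Qed.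

HB.instance Definition _ := Lmodule_isNormed.Build C osub
  osub_normD osub_normZ osub_norm0_eq0.

Lemma osub_complete (F : set_system osub) : ProperFilter F -> cauchy F -> cvg F.
Proof.
move=> FF /cauchy_ballP Fc.
have oc : cauchy (oval @ F).
  apply/cauchy_ballP => e e0; have [[P S]/= [FP FS] PS] := Fc _ e0.
  exists (oval @` P, oval @` S) => /=.
    by split; [apply: filterS FP|apply: filterS FS] => x Px; exists x.
  move=> [_ _] /= [[x Px <-] [y Sy <-]].
  by have := PS (x, y) (conj Px Sy); rewrite -!ball_normE.
have /cvg_ex[/= l hl] : cvg (oval @ F) by exact/cauchy_cvgP.
have lG : orthocomplement G l.
  apply: (closed_cvg (orthocomplement G)) hl; first exact: orthocomplement_closed.
  by apply: nearW => x; apply/asboolP; exact: (ovalP x).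
have lP : l \in orth_pred by apply/asboolP.
apply/cvg_ex; exists (Osub lP); apply/cvgrPdist_le => e e0.
by move/cvgrPdist_le : hl => /(_ _ e0).
Qed.

HB.instance Definition _ := Uniform_isComplete.Build osub osub_complete.

Lemma osub_inner_norm x : form x x = `|x| ^+ 2.
Proof. exact: inner_norm. Qed.

HB.instance Definition _ := NormedModule_isHilbert.Build R osub osub_inner_norm.

Lemma osub_innerE x y : inner x y = inner (oval x) (oval y).
Proof. by []. Qed.

Lemma osub_orth x : orthocomplement G (oval x).
Proof. by apply/asboolP; exact: ovalP. Qed.

Lemma osub_lift w : orthocomplement G w -> exists x, oval x = w.
Proof. by move=> /asboolP Gw; exists (Osub Gw). Qed.

Lemma osub_restrict (V : H -> H) :
  (forall w, orthocomplement G w -> orthocomplement G (V w)) ->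
  exists T : osub -> osub, forall x, oval (T x) = V (oval x).
Proof.
move=> VG; suff /choice[T hT] x : exists y : osub, oval y = V (oval x) by exists T.
by apply: osub_lift; apply: VG; exact: osub_orth.
Qed.

End orthocomplement_type.

Lemma osub_operator (R : realType) (H : hilbertType R) (G : set H)
    (V : bounded_operator H H) :
  (forall w, orthocomplement G w -> orthocomplement G (V w)) ->
  exists T : bounded_operator (osub G) (osub G), forall x, oval (T x) = V (oval x).
Proof.
move=> /osub_restrict[f fE].
have fl : linear f.
  by move=> a x y; apply: val_inj; rewrite [LHS]fE !linearP/= !fE.
pose F : {linear osub G -> osub G} := HB.pack f (GRing.isLinear.Build _ _ _ _ f fl).
suff Fc : continuous F by exists (BoundedOperator Fc).
have [c hc] := operator_bounded V.
by apply: (@bounded_continuous _ _ _ _ c) => // x; have := hc (oval x); rewrite -fE.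
Qed.

(** * Synthesis along several ladders *)

Section iterated_synthesis.
Variables (R : realType) (H : hilbertType R) (J : finType) (k : J -> part).
Variables (A B Q : J -> H -> H).
Local Notation C := R[i].
Hypothesis lad : forall i, ladder (A i) (B i) (Q i) (part_length (k i)).
Hypothesis QA : forall i j, i != j -> forall x, Q i (A j x) = A j (Q i x).
Hypothesis QQC : forall i j x, Q i (Q j x) = Q j (Q i x).
Local Notation F i := (Defs.factor R (k i)).
Implicit Types (l : seq J) (x y : forall i, F i) (w z : H).

Definition fixed l w := forall i, i \in l -> Q i w = w.

(** The vector x_1(A_1) (x_2(A_2) (... w)), where x_i(A_i) is the sum over m of
    x_i(m) A_i^m: the image of an elementary tensor, built one factor at a
    time. *)
Definition tens_seq l x w : H := foldr (fun i v => part_synth (A i) (x i) v) w l.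

Lemma eq_tens_seq l x y w : (forall i, i \in l -> x i = y i) ->
  tens_seq l x w = tens_seq l y w.
Proof.
elim: l => //= i l IH xy; rewrite xy ?mem_head// IH// => j jl.
by apply: xy; rewrite inE jl orbT.
Qed.

Lemma fixed_cons i l w : fixed (i :: l) w -> Q i w = w /\ fixed l w.
Proof.
move=> h; split=> [|j jl]; first by apply: h; rewrite mem_head.
by apply: h; rewrite inE jl orbT.
Qed.

Lemma projection_tens_seq l x w j : uniq l -> j \notin l -> fixed l w ->
  Q j (tens_seq l x w) = tens_seq l x (Q j w).
Proof.
elim: l w j => //= i l IH w j /andP[il ul]; rewrite inE negb_or => /andP[ji jl].
move=> /fixed_cons[iw lw].
have fv : Q i (tens_seq l x w) = tens_seq l x w by rewrite IH// iw.
rewrite (part_synth_comm _ (lad i) fv (lad_Qadj (lad j)) _ (QA ji)); first by rewrite IH.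
by rewrite QQC fv.
Qed.

Lemma tens_seq_fixed l x w j : uniq l -> j \notin l -> fixed l w -> Q j w = w ->
  Q j (tens_seq l x w) = tens_seq l x w.
Proof. by move=> ul jl lw jw; rewrite projection_tens_seq// jw. Qed.

Lemma inner_tens_seq l x y w w' : uniq l -> fixed l w -> fixed l w' ->
  inner (tens_seq l x w) (tens_seq l y w') =
  (\prod_(i <- l) inner (x i) (y i)) * inner w w'.
Proof.
elim: l => [|i l IH] /=; first by rewrite big_nil mul1r.
move=> /andP[il ul] /fixed_cons[iw lw] /fixed_cons[iw' lw'].
rewrite (inner_part_synth _ _ (lad i)) ?tens_seq_fixed// IH//.
by rewrite big_cons mulrA.
Qed.

Lemma part_synth_rung i m w : Q i w = w ->
  exists a : F i, part_synth (A i) a w = iter m (A i) w.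
Proof.
move=> wQ; have ladi := lad i.
have sysN := nat_orthogonal_system ladi; have sysO := ord_orthogonal_system ladi.
case: (k i) ladi sysN sysO => [||p|] ladi sysN sysO /=.
- by exists (l2_basis R m); rewrite (synth_basis (sysN erefl)).
- by exists (l2_basis R m); rewrite (synth_basis (sysN erefl)).
- have [mp|pm] := ltnP m p.
    by exists (l2_basis R (Ordinal mp)); rewrite (synth_basis (sysO _ erefl)).
  exists 0; rewrite (lin0 (synth_lin (sysO _ erefl) _))//.
  rewrite -(subnK pm) iterD -[w]wQ (lad_top ladi)//.
  by rewrite (lin0 (adj_lin (adj_iter _ (lad_adj ladi)))).
- by exists (l2_basis R m); rewrite (synth_basis (sysN erefl)).
Qed.

(** Totality is proved one ladder at a time: if z is orthogonal to all the
    vectors built on i :: l, then each Q_i B_i^m z is orthogonal to all those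
    built on l, because Q_i passes through the other ladders. *)
Lemma tens_seq_total l z : uniq l ->
  (forall x w, fixed l w -> inner z (tens_seq l x w) = 0) -> z = 0.
Proof.
elim: l z => [|i l IH] z /=.
  by move=> _ h; apply: inner_eq0; apply: (h (fun i => 0)).
move=> /andP[il ul] h; apply: (lad_total (lad i)) => m.
apply: (IH _ ul) => x w lw; rewrite (lad_Qadj (lad i)) projection_tens_seq//.
rewrite (adj_iter m (adjC (lad_adj (lad i)))).
have lQw : fixed l (Q i w) by move=> j jl; rewrite QQC lw.
have iQw : Q i (Q i w) = Q i w by exact: lad_QQ (lad i) w.
have fv : Q i (tens_seq l x (Q i w)) = tens_seq l x (Q i w) by rewrite tens_seq_fixed.
have [a <-] := part_synth_rung m fv.
have -> : tens_seq l x (Q i w) = tens_seq l (dfwith x i a) (Q i w).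
  by apply: eq_tens_seq => j jl; rewrite dfwithout//; apply: contraNneq il => ->.
have := h (dfwith x i a) (Q i w); rewrite dfwithin; apply.
by move=> j; rewrite inE => /orP[/eqP-> //|/lQw].
Qed.

Section action.
Variables (V : H -> H) (act : forall i, F i -> F i).

Lemma tens_seq_push l x w : uniq l -> fixed l w ->
  (forall i, i \in l -> forall a v, Q i v = v ->
    V (part_synth (A i) a v) = part_synth (A i) (@act i a) (V v)) ->
  V (tens_seq l x w) = tens_seq l (fun i => @act i (x i)) (V w).
Proof.
elim: l => //= i l IH /andP[il ul] /fixed_cons[iw lw] h.
rewrite h ?mem_head ?tens_seq_fixed// IH// => j jl; apply: h.
by rewrite inE jl orbT.
Qed.

(** An operator that passes the ladders before the j-th one acts on each of them
    and stops at the j-th, so that the later factors are left alone. *)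
Lemma tens_seq_act l1 j l2 x w : uniq (l1 ++ j :: l2) -> fixed (l1 ++ j :: l2) w ->
  (forall i, i \in l1 -> forall a v, Q i v = v ->
    V (part_synth (A i) a v) = part_synth (A i) (@act i a) (V v)) ->
  (forall a v, Q j v = v -> V (part_synth (A j) a v) = part_synth (A j) (@act j a) v) ->
  (forall i, i \in l2 -> forall a : F i, @act i a = a) ->
  V (tens_seq (l1 ++ j :: l2) x w) =
  tens_seq (l1 ++ j :: l2) (fun i => @act i (x i)) w.
Proof.
move=> ul lw h1 hj h2.
have fl1 i : i \in l1 -> Q i w = w by move=> il; apply: lw; rewrite mem_cat il.
have fj : Q j w = w by apply: lw; rewrite mem_cat mem_head orbT.
have fl2 i : i \in l2 -> Q i w = w.
  by move=> il; apply: lw; rewrite mem_cat inE il !orbT.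
move: ul; rewrite cat_uniq => /and3P[ul1 /hasPn dis ul2].
have tcat y : tens_seq (l1 ++ j :: l2) y w = tens_seq l1 y (tens_seq (j :: l2) y w).
  by rewrite /tens_seq foldr_cat.
have /andP[jl2 ul2'] := ul2.
rewrite !tcat tens_seq_push//; last first.
  move=> i il1; apply: tens_seq_fixed => //; last exact: fl1.
    by apply/negP => /dis /negP.
  by move=> m; rewrite inE => /orP[/eqP->//|]; exact: fl2.
congr (tens_seq _ _ _) => /=; rewrite hj; last by rewrite tens_seq_fixed.
congr part_synth; apply: eq_tens_seq => i il2; by rewrite h2.
Qed.

End action.

End iterated_synthesis.

(** * Tensor products *)

Section tensor_products.
Variable R : realType.
Local Notation C := R[i].

Definition tensor_sums (J : finType) (F : J -> hilbertType R) (T : hilbertType R)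
    (t : (forall j, F j) -> T) : set T :=
  [set w : T | exists (m : nat) (c : 'I_m -> R[i]) (x : 'I_m -> forall j, F j),
     w = \sum_(k < m) c k *: t (x k)].

Lemma tensor_sums_linear (J : finType) (F : J -> hilbertType R) (T : hilbertType R)
  (t : (forall j, F j) -> T) : linear_subspace (tensor_sums t).
Proof.
split.
  exists 0%N, (fun=> 0), (fun=> (fun=> 0)); by rewrite big_ord0.
move=> a _ _ [m [c [x ->]]] [m' [c' [x' ->]]].
exists (m + m')%N.
exists (fun k => match fintype.split k with inl i => a * c i | inr i => c' i end).
exists (fun k => match fintype.split k with inl i => x i | inr i => x' i end).
rewrite big_split_ord/= scaler_sumr; congr (_ + _); apply: eq_bigr => i _.
  by rewrite -[lshift _ _]/(unsplit (inl _)) unsplitK scalerA.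
by rewrite -[rshift _ _]/(unsplit (inr _)) unsplitK.
Qed.

Lemma total_of_orth (J : finType) (F : J -> hilbertType R) (T : hilbertType R)
    (t : (forall j, F j) -> T) :
  (forall z, (forall x, inner z (t x) = 0) -> z = 0) ->
  closure (tensor_sums t) = setT.
Proof.
move=> tot; apply/seteqP; split => // z _.
have [p [Sp zp]] := projection z (tensor_sums_linear t).
suff /eqP : z - p = 0 by rewrite subr_eq0 => /eqP ->.
apply: tot => x; apply: zp; exists 1%N, (fun=> 1), (fun=> x).
by rewrite big_ord_recl big_ord0 addr0 scale1r.
Qed.

Lemma orth_of_total (J : finType) (F : J -> hilbertType R) (K : tensor_product F) z :
  (forall x, inner z (tens K x) = 0) -> z = 0.
Proof.
move=> zt; have : closure (orthocomplement [set z]) z.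
  have : closure (tensor_sums (@tens _ _ _ K)) z by rewrite /tensor_sums tens_total.
  apply: closure_subset => _ [m [c [x ->]]] _ ->.
  rewrite linear_sumlz big1//= => k _.
  by rewrite innerZl innerC zt conjC0 mulr0.
have /closure_id <- := @orthocomplement_closed _ _ [set z].
by move=> /(_ z erefl)/inner_eq0.
Qed.

(** The failure of linearity in one entry is orthogonal to all elementary
    tensors. *)
Lemma multilinear_of_inner (J : finType) (F : J -> hilbertType R) (T : hilbertType R)
    (t : (forall j, F j) -> T) :
  (forall x y, inner (t x) (t y) = \prod_j inner (x j) (y j)) ->
  (forall z, (forall x, inner z (t x) = 0) -> z = 0) ->
  forall (x : forall j, F j) (j : J) (a : C) (u v : F j),
    t (dfwith x j (a *: u + v)) = a *: t (dfwith x j u) + t (dfwith x j v).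
Proof.
move=> tin tot x j a u v; apply/eqP; rewrite -subr_eq0; apply/eqP/tot => y.
rewrite innerBl innerDl innerZl !tin !(bigD1 (P := xpredT) j)//= !dfwithin.
have E w : \prod_(i | i != j) inner (dfwith x j w i) (y i) =
    \prod_(i | i != j) inner (x i) (y i).
  by apply: eq_bigr => i ij; rewrite dfwithout// eq_sym.
rewrite !E innerDl innerZl mulrDl mulrA; exact: subrr.
Qed.

Lemma orthocomplement_stable (H : hilbertType R) (T T' : H -> H) (G : set H) :
  adj T T' -> (forall x, G x -> G (T x)) ->
  forall x, orthocomplement G x -> orthocomplement G (T' x).
Proof. by move=> TT' GT x Gx y Gy; rewrite (adjC TT') Gx//; exact: GT. Qed.

(** A reducing subspace N of one factor gives the reducing subspace M spanned by
    the elementary tensors G2 with that entry in N. It is also the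
    orthocomplement of the elementary tensors G with that entry orthogonal to N,
    and the stability of G and G2 under the W i makes M reducing. *)
Lemma tensor_factor_irreducible (J : finType) (F : J -> hilbertType R)
    (K : tensor_product F) (o : J) (I I' : Type) (W : I -> bounded_operator K K)
    (act : I -> forall j, F j -> F j) (T : I' -> bounded_operator (F o) (F o)) :
  (forall i x, W i (tens K x) = tens K (fun j => act i j (x j))) ->
  (forall i, (exists i', act i o =1 T i') \/ act i o =1 id) ->
  (forall j, exists v : F j, inner v v != 0 \/ j = o) ->
  irreducible_family W -> irreducible_family T.
Proof.
move=> WE actT unit [[z0 z00] irrW].
pose Om j : F j := sval (cid (unit j)).
have Om1 j : inner (Om j) (Om j) != 0 \/ j = o := svalP (cid (unit j)).
split.
  apply: contrapT => /forallNP Fo0; move/eqP : z00; apply.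
  apply: orth_of_total => x; suff -> : tens K x = 0 by rewrite inner0r.
  apply: inner_eq0; rewrite inner_tens (bigD1 o)//=.
  by have /negP/negPn/eqP -> := Fo0 (x o); rewrite inner0l mul0r.
move=> N Ncl Nlin Nred.
pose G := [set w | exists2 x, orthocomplement N (x o) & w = tens K x].
pose G2 := [set w | exists2 x, N (x o) & w = tens K x].
pose M := orthocomplement G.
have splitN (u : F o) : exists p q, [/\ N p, orthocomplement N q & u = p + q].
  have [p [Np pu]] := closed_projection u Ncl Nlin.
  by exists p, (u - p); split => //; rewrite addrC subrK.
have tensD (x : forall j, F j) (p q : F o) :
    tens K (dfwith x o (p + q)) = tens K (dfwith x o p) + tens K (dfwith x o q).
  by have := tens_multilinear K x 1 p q; rewrite !scale1r.
have tens_dfwith (x : forall j, F j) : tens K x = tens K (dfwith x o (x o)).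
  congr (tens K _); apply: functional_extensionality_dep => j.
  by have [<-|jo] := eqVneq o j; [rewrite dfwithin|rewrite dfwithout].
have GG2 g g2 : G g -> G2 g2 -> inner g g2 = 0.
  move=> [x xN ->] [y yN ->]; rewrite inner_tens (bigD1 o)//=.
  by rewrite xN// mul0r.
have G2M z : orthocomplement (orthocomplement G2) z -> M z.
  by move=> G2z g Gg; apply: G2z => g2 G2g2; exact: GG2.
have MG2 z : M z -> orthocomplement (orthocomplement G2) z.
  move=> Mz.
  have [u [u2 zu]] := closed_projection z (@orthocomplement_closed _ _ G2)
    (@orthocomplement_linear _ _ G2).
  have Mzu := G2M _ zu.
  suff u0 : u = 0 by rewrite u0 subr0 in zu.
  apply: orth_of_total => x; rewrite tens_dfwith.
  have [p [q [Np Nq ->]]] := splitN (x o); rewrite tensD innerDr.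
  have -> : inner u (tens K (dfwith x o p)) = 0.
    by apply: u2; exists (dfwith x o p) => //; rewrite dfwithin.
  have Gq : G (tens K (dfwith x o q)) by exists (dfwith x o q) => //; rewrite dfwithin.
  have -> : u = z - (z - u) by rewrite opprB addrC subrK.
  by rewrite innerBl Mz// Mzu// subrr addr0.
have actN i (u : F o) : N u -> N (act i o u).
  by move=> Nu; have [[i' ->]|-> //] := actT i; have [+ _] := Nred i'; apply.
have actN' i (u : F o) : orthocomplement N u -> orthocomplement N (act i o u).
  by move=> Nu; have [[i' ->]|-> //] := actT i; have [_ +] := Nred i'; apply.
have GW i x : G x -> G (W i x).
  by move=> [y yN ->]; rewrite WE; eexists; last reflexivity; exact: actN'.
have G2W i x : G2 x -> G2 (W i x).
  by move=> [y yN ->]; rewrite WE; eexists; last reflexivity; exact: actN.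
have Wadj i := @operator_adj _ _ _ (W i).
have Mred i : reduces M (W i).
  split => x.
    move=> /MG2 Mx; apply: G2M; apply: orthocomplement_stable (adjC (Wadj i)) _ _ Mx.
    exact: orthocomplement_stable (Wadj i) (G2W i).
  move=> Mx; apply: orthocomplement_stable (adjC (Wadj i)) _ _ Mx.
  exact: orthocomplement_stable (Wadj i) (GW i).
have tens0 (u : F o) : tens K (dfwith Om o u) = 0 -> u = 0.
  move=> h; apply: inner_eq0; have := inner_tens K (dfwith Om o u) (dfwith Om o u).
  rewrite h inner0l (bigD1 o)//= dfwithin => /esym/eqP; rewrite mulf_eq0 => /orP[/eqP//|].
  rewrite prodf_seq_eq0 => /hasP[j _ /andP[jo]]; rewrite dfwithout; last by rewrite eq_sym.
  by have [/negPf->|jo'] := Om1 j; last by rewrite jo' eqxx in jo.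
have [M0|MT] := irrW M (@orthocomplement_closed _ _ G) (@orthocomplement_linear _ _ G) Mred.
  left; apply/seteqP; split => [u Nu|_ ->]; last by case: Nlin.
  apply: tens0; have : M (tens K (dfwith Om o u)).
    apply: G2M => y; rewrite innerC => G2y; rewrite G2y ?conjC0//.
    by exists (dfwith Om o u) => //; rewrite dfwithin.
  by rewrite M0.
right; apply/seteqP; split => // u _.
have [p [q [Np Nq ->]]] := splitN u.
suff -> : q = 0 by rewrite addr0.
apply: tens0; have : M (tens K (dfwith Om o q)) by rewrite MT.
move=> /(_ (tens K (dfwith Om o q)))/(_ _)/inner_eq0; apply.
by exists (dfwith Om o q) => //; rewrite dfwithin.
Qed.

End tensor_products.

(** * The normal form *)

Definition part_spec (R : realType) (H : hilbertType R) (A B Q : H -> H) (k : part) : Prop :=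
  match k with
  | Phi_s => ladder A B Q None
  | Phi_b => ladder B A Q None
  | Phi_ p => (0 < p)%N /\ ladder A B Q (Some p)
  | Phi_u => (forall x, A (B x) = x) /\ (forall x, B (A x) = x)
  end.

Section normal_form.
Variables (R : realType) (n : nat) (H : hilbertType R).
Variables (V : 'I_n -> bounded_operator H H) (lam : 'I_n -> 'I_n -> R[i]).
Local Notation C := R[i].
Local Notation V' i := (adjoint (V i)).
Hypothesis lam_norm : forall i j, i != j -> `|lam i j| = 1.
Hypothesis lam_conj : forall i j, i != j -> lam j i = (lam i j)^*.
Hypothesis V'V : forall i j, i != j -> forall x, V' i (V j x) = lam i j *: V j (V' i x).
Hypothesis VV : forall i j, i != j -> forall x, V i (V j x) = lam j i *: V j (V i x).
Hypothesis irr : irreducible_family V.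

Let Vadj i : adj (V i) (V' i) := operator_adj (V i).
Let Vlin i : lin (V i) := adj_lin (Vadj i).
Let V'lin i : lin (V' i) := adj_lin (adjC (Vadj i)).

Lemma lam_mulC i j : i != j -> lam i j * (lam i j)^* = 1.
Proof. by move=> ij; rewrite -normCK lam_norm// expr1n. Qed.

Lemma twisted_V i j : i != j -> twisted_commute (V i) (V' i) (V j) (lam i j).
Proof.
move=> ij; have ji : j != i by rewrite eq_sym.
split=> [||x|x]; [exact: Vlin|exact: lam_norm|by rewrite VV|].
by rewrite V'V// scalerA mulrC lam_mulC// scale1r.
Qed.

Lemma twisted_V' i j : i != j -> twisted_commute (V i) (V' i) (V' j) (lam i j)^*.
Proof.
move=> ij; have ji : j != i by rewrite eq_sym.
split=> [||x|x]; [exact: V'lin|by rewrite norm_conjC lam_norm|by rewrite V'V// lam_conj|].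
apply: inner_ext => z; rewrite innerZl !(adjC (Vadj _)) VV// innerZr lam_conj//.
Qed.

(** The other V_j and their adjoints commute with V_i and its adjoint up to
    phases, so irreducibility makes the classification apply to V_i. *)
Lemma exists_part i : power_partial_isometry (V i) ->
  exists k Q, part_spec (V i) (V' i) Q k.
Proof.
move=> ppV; have [x0 _] := irr.
have [|[p [Q [p0 lad]]]|[Q lad]|[Q lad]|h] := ppi_classification (power_partial_isometry_ppi ppV) x0.
- move=> G GX GV GV'; apply: (irreducible_total irr) => j x Gx.
    by have [<-|ij] := eqVneq i j; [exact: GV|exact: GX (twisted_V ij) _ Gx].
  by have [<-|ij] := eqVneq i j; [exact: GV'|exact: GX (twisted_V' ij) _ Gx].
- by exists (Phi_ p), Q.
- by exists Phi_s, Q.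
- by exists Phi_b, Q.
- by exists Phi_u, id.
Qed.

Variables (Phi : 'I_n -> part) (Q : 'I_n -> H -> H).
Hypothesis spec : forall i, part_spec (V i) (V' i) (Q i) (Phi i).

(** A backward shift is a ladder climbed by its adjoint. *)
Definition up i : H -> H := if Phi i is Phi_b then V' i else V i.
Definition down i : H -> H := if Phi i is Phi_b then V i else V' i.

Local Notation J := (index_factor Phi).

Lemma up_ladder (i : J) :
  ladder (up (val i)) (down (val i)) (Q (val i)) (part_length (Phi (val i))).
Proof.
case: i => i /= iu; have := spec i; rewrite /up /down /part_spec.
by move: iu; case: (Phi i) => [||p|]//= _ [].
Qed.

(** The phase that V_j picks up when it passes the i-th ladder. *)
Definition phase i j : C := if Phi i is Phi_b then lam j i else lam i j.

Lemma twisted_up i j : i != j -> twisted_commute (up i) (down i) (V j) (phase i j).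
Proof.
move=> ij; rewrite /up /down /phase; have tw := twisted_V ij.
have := twisted_commuteC tw; rewrite -lam_conj//.
by case: (Phi i).
Qed.

Lemma twisted_up' i j : i != j -> twisted_commute (up i) (down i) (V' j) (phase i j)^*.
Proof.
move=> ij; rewrite /up /down /phase; have tw := twisted_V' ij.
have := twisted_commuteC tw; rewrite -lam_conj//.
by case: (Phi i).
Qed.

Lemma Q_V (i : J) j : val i != j -> forall x, V j (Q (val i) x) = Q (val i) (V j x).
Proof. by move=> ij; exact: lad_comm (up_ladder i) _ _ (twisted_up ij). Qed.

Lemma Q_V' (i : J) j : val i != j -> forall x, V' j (Q (val i) x) = Q (val i) (V' j x).
Proof. by move=> ij; exact: lad_comm (up_ladder i) _ _ (twisted_up' ij). Qed.

Lemma Q_up (i j : J) : i != j ->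
  forall x, Q (val i) (up (val j) x) = up (val j) (Q (val i) x).
Proof.
rewrite -(inj_eq val_inj) => ij x; rewrite /up.
by case: (Phi (val j)); rewrite ?Q_V ?Q_V'.
Qed.

Lemma Q_down (i j : J) : i != j ->
  forall x, Q (val i) (down (val j) x) = down (val j) (Q (val i) x).
Proof.
rewrite -(inj_eq val_inj) => ij x; rewrite /down.
by case: (Phi (val j)); rewrite ?Q_V ?Q_V'.
Qed.

Lemma Q_Q (i j : J) x : Q (val i) (Q (val j) x) = Q (val j) (Q (val i) x).
Proof.
have [->//|ij] := eqVneq i j.
apply: (lad_comm (up_ladder j) (nu := 1)); split=> [||y|y].
- exact: adj_lin (lad_Qadj (up_ladder i)).
- exact: normr1.
- by rewrite scale1r Q_up.
- by rewrite conjC1 scale1r Q_down.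
Qed.

(** Its orthocomplement, the space H_u of the model, is the common range of the
    commuting projections Q_i, that is the intersection of the first rungs. *)
Definition vacuum_perp : set H := [set z | exists (i : J) y, z = y - Q (val i) y].
Local Notation W := (osub vacuum_perp).

Lemma vacuumP w :
  orthocomplement vacuum_perp w <-> forall i : J, Q (val i) w = w.
Proof.
split=> [h i|h _ [i [y ->]]].
  apply/esym/eqP; rewrite -subr_eq0; apply/eqP/inner_ext => z.
  rewrite inner0l innerBl (lad_Qadj (up_ladder i)) -innerBr.
  by apply: h; exists i, z.
by rewrite innerBr -(lad_Qadj (up_ladder i)) h subrr.
Qed.

Lemma vacuum_fixed (w : W) (i : J) : Q (val i) (oval w) = oval w.
Proof. by have /vacuumP := osub_orth w. Qed.

Lemma V_vacuum j : in_Phi_u (Phi j) ->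
  forall w, orthocomplement vacuum_perp w -> orthocomplement vacuum_perp (V j w).
Proof.
move=> ju w /vacuumP h; apply/vacuumP => i; rewrite -Q_V ?h//.
by apply: contraTneq ju => <-; exact: (valP i).
Qed.

Lemma V'_vacuum j : in_Phi_u (Phi j) ->
  forall w, orthocomplement vacuum_perp w -> orthocomplement vacuum_perp (V' j w).
Proof.
move=> ju w /vacuumP h; apply/vacuumP => i; rewrite -Q_V' ?h//.
by apply: contraTneq ju => <-; exact: (valP i).
Qed.

(** The tensor factors are peeled off in the order Phi_s, Phi_b, Psi, and by
    increasing index inside each of these classes: V_j passes exactly the factors
    that come before its own. *)
Definition rank (k : part) : nat :=
  match k with Phi_s => 0 | Phi_b => 1 | Phi_ _ => 2 | Phi_u => 3 end.

Definition key (i : 'I_n) : nat := rank (Phi i) * n + i.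

(** As i < n, comparing keys is comparing pairs (rank, index) lexicographically. *)
Lemma key_le i j : (key i <= key j)%N ->
  (rank (Phi i) < rank (Phi j))%N \/ rank (Phi i) = rank (Phi j) /\ (i <= j)%N.
Proof.
rewrite /key => h; have := ltn_ord i; have := ltn_ord j.
move: h; set a := rank _; set b := rank _ => h hj hi.
have [ab|ba|abE] := ltngtP a b; first by left.
  have : (b.+1 * n <= a * n)%N by rewrite leq_mul2r ba orbT.
  by rewrite mulSn; lia.
by right; split => //; move: h; rewrite abE leq_add2l.
Qed.

Definition index_seq : seq J := sort (fun i j => key (val i) <= key (val j))%N (enum {: J}).

Lemma index_seq_uniq : uniq index_seq.
Proof. by rewrite sort_uniq enum_uniq. Qed.

Lemma mem_index_seq i : i \in index_seq.
Proof. by rewrite mem_sort mem_enum. Qed.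

Lemma index_seq_split j : exists l1 l2, [/\ index_seq = l1 ++ j :: l2,
  forall i, i \in l1 -> i != j /\ (key (val i) <= key (val j))%N &
  forall i, i \in l2 -> i != j /\ (key (val j) <= key (val i))%N].
Proof.
have srt : pairwise (fun i j : J => key (val i) <= key (val j))%N index_seq.
  rewrite -sorted_pairwise; last by move=> x y z; exact: leq_trans.
  by apply: sort_sorted => x y; exact: leq_total.
have := index_seq_uniq; move: srt.
case/splitPr: {1 2 3}index_seq / (mem_index_seq j) => l1 l2.
rewrite pairwise_cat /= => /and3P[/allrelP h1 _ /andP[/allP h2 _]].
rewrite cat_uniq /= => /and3P[_ /norP[jl1 _] /andP[jl2 _]].
exists l1, l2; split => // i il.
  by split; [apply: contraNneq jl1 => <-|apply: h1 => //; rewrite mem_head].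
by split; [apply: contraNneq jl2 => <-|exact: h2].
Qed.

Variable Uu : index_u Phi -> bounded_operator W W.
Hypothesis UuE : forall j w, oval (Uu j w) = V (val j) (oval w).

Lemma adjoint_Uu j w : oval (adjoint (Uu j) w) = V' (val j) (oval w).
Proof.
have [T hT] := osub_restrict (V'_vacuum (valP j)).
rewrite (@adjointE _ _ _ _ T) ?hT// => x y.
by rewrite !osub_innerE UuE hT (Vadj (val j)).
Qed.

Lemma Uu_unitary j : unitary_operator (Uu j).
Proof.
have := spec (val j); have := valP j; rewrite /part_spec; case: (Phi _) => // _ [VV1 V'V1].
by split=> w; apply: val_inj; rewrite [LHS]/= ?(UuE, adjoint_Uu) ?VV1 ?V'V1.
Qed.

Lemma Uu_twisted i j : i != j -> forall w,
  adjoint (Uu i) (Uu j w) = lam (val i) (val j) *: Uu j (adjoint (Uu i) w).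
Proof.
move=> ij w; apply: val_inj; rewrite [LHS]adjoint_Uu UuE V'V//.
by rewrite [RHS]/= UuE adjoint_Uu.
Qed.

Local Notation F := (@model_factor R n Phi W).

(** The elementary tensors, realized inside H itself. *)
Definition tensor (x : forall o, F o) : H :=
  tens_seq (fun i : J => up (val i)) index_seq (fun i => x (Some i)) (oval (x None)).

Lemma inner_tensor x y : inner (tensor x) (tensor y) = \prod_o inner (x o) (y o).
Proof.
rewrite (inner_tens_seq up_ladder (@Q_up) Q_Q) ?index_seq_uniq//; try by move=> i _; exact: vacuum_fixed.
rewrite (bigD1 (P := xpredT) None)//= mulrC; congr (_ * _).
rewrite (perm_big (enum {: J})) ?perm_sort// big_enum/=.
rewrite (reindex_omap Some id)//=; last by case.
by apply: eq_bigl => i; rewrite eqxx.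
Qed.

Lemma tensor_total z : (forall x, inner z (tensor x) = 0) -> z = 0.
Proof.
move=> h; apply: (tens_seq_total up_ladder (@Q_up) Q_Q index_seq_uniq) => x w fw.
have [v vw] : exists v : W, oval v = w.
  by apply/osub_lift/vacuumP => i; apply: fw; exact: mem_index_seq.
rewrite -vw.
pose y o : F o := match o with Some i => x i | None => v end.
exact: (h y).
Qed.

Lemma factor_action_before i j : i != j ->
  (rank (Phi i) < rank (Phi j))%N \/ rank (Phi i) = rank (Phi j) /\ (i <= j)%N ->
  ~~ in_Phi_u (Phi i) ->
  forall a, @factor_action R n Phi lam j i a = diag_action (phase i j) a.
Proof.
move=> ij; rewrite /factor_action (negPf ij) /phase.
have ltij : (i <= j)%N = (i < j)%N by rewrite ltn_neqAle ij.
case: (Phi i) => [||p|]; case: (Phi j) => [||q|]//= h _ a;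
  by [|case: h => [|[]]|case: h => // -[_]; rewrite ltij => ->].
Qed.

Lemma factor_action_after i j : i != j ->
  (rank (Phi j) < rank (Phi i))%N \/ rank (Phi j) = rank (Phi i) /\ (j <= i)%N ->
  forall a, @factor_action R n Phi lam j i a = a.
Proof.
move=> ij; rewrite /factor_action (negPf ij).
have ltji : (j <= i)%N -> (i < j)%N = false by move=> ji; rewrite ltnNge ji.
case: (Phi i) => [||p|]; case: (Phi j) => [||q|]//= h a;
  by [|case: h => [|[]]|case: h => // -[_ /ltji ->]].
Qed.

Lemma V_own (j : J) a v : Q (val j) v = v ->
  V (val j) (part_synth (up (val j)) a v) =
  part_synth (up (val j)) (@factor_action R n Phi lam (val j) (val j) a) v.
Proof.
move=> fv; have := up_ladder j; rewrite /factor_action eqxx /up /down.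
case: j fv a => j /= ju fv; move: ju.
case: (Phi j) => [||p|]//= _ a lad.
- exact: (@part_synth_forward _ _ Phi_s _ _ _ _ _ lad fv).
- exact: (part_synth_backward _ lad fv).
- exact: (@part_synth_forward _ _ (Phi_ p) _ _ _ _ _ lad fv).
Qed.

Lemma V_pass (i : J) j : val i != j ->
  (rank (Phi (val i)) < rank (Phi j))%N \/
    rank (Phi (val i)) = rank (Phi j) /\ (val i <= j)%N ->
  forall a v, Q (val i) v = v ->
  V j (part_synth (up (val i)) a v) =
  part_synth (up (val i)) (@factor_action R n Phi lam j (val i) a) (V j v).
Proof.
move=> ij h a v fv; rewrite factor_action_before//; last exact: (valP i).
exact: part_synth_diag (up_ladder i) fv (Vadj j) (twisted_up ij).
Qed.

(** For j in Phi_u, the operator V_j passes all the ladders and reaches H_u;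
    otherwise it stops at its own ladder. *)
Lemma V_tensor j x : V j (tensor x) = tensor (fun o => model_action lam Uu j (x o)).
Proof.
have fw i : i \in index_seq -> Q (val i) (oval (x None)) = oval (x None).
  by move=> _; exact: vacuum_fixed.
rewrite /tensor; have [ju|ju] := boolP (in_Phi_u (Phi j)).
  rewrite (tens_seq_push up_ladder (@Q_up) Q_Q (act := fun i => @factor_action R n Phi lam j (val i)))
    ?index_seq_uniq//.
    by rewrite /= insubT/= UuE.
  move=> i _; apply: V_pass.
    by apply: contraTneq ju => <-; exact: (valP i).
  by left; have := valP i; move: ju => /=; case: (Phi j) => //=; case: (Phi (val i)).
pose jJ : J := Sub j ju.
have [l1 [l2 [lE h1 h2]]] := index_seq_split jJ.
have := index_seq_uniq; move: fw; rewrite lE => fw ul.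
rewrite (tens_seq_act up_ladder (@Q_up) Q_Q (act := fun i => @factor_action R n Phi lam j (val i)) _ ul fw).
- by rewrite /= insubN// ju.
- move=> i /h1[ij /key_le h]; apply: V_pass => //.
- exact: V_own.
- move=> i /h2[ij /key_le h]; exact: factor_action_after.
Qed.

Lemma exists_unit_vector (o : option J) :
  exists v : F o, inner v v != 0 \/ o = None.
Proof.
case: o => [i|]; last by exists 0; right.
have unit_basis (I : choiceType) (k : I) : inner (l2_basis R k) (l2_basis R k) != 0.
  by rewrite inner_basis l2_basisE eqxx oner_eq0.
have := spec (val i); rewrite /model_factor.
case: (Phi (val i)) => [||p [p0 _]|] *; last 1 first.
all: try by exists (l2_basis R 0%N); left; exact: unit_basis.
by exists (l2_basis R (Ordinal p0)); left; exact: unit_basis.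
Qed.

(** H with the map [tensor] is a tensor product of the factors, on which the
    operators V_j themselves have the required form: the unitary equivalence is
    the identity. *)
Theorem normal_form_tensor : exists (K : tensor_product F) (X : 'I_n -> bounded_operator K K),
  [/\ irreducible_family Uu,
      forall j x, X j (tens K x) = tens K (fun o => model_action lam Uu j (x o)) &
      unitarily_equivalent V X].
Proof.
pose K := TensorProduct (multilinear_of_inner inner_tensor tensor_total) inner_tensor
  (total_of_orth tensor_total).
exists K, V; split=> [|j x|]; last 1 first.
- have idc : continuous (idfun : {linear H -> K}) by move=> x; exact: cvg_id.
  exists (BoundedOperator idc).
    by split=> x; rewrite (adjointE (@adj_id _ H)).
  by move=> j y /=; rewrite (adjointE (@adj_id _ H)).
- apply: (@tensor_factor_irreducible _ _ _ K None _ _ V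
    (fun j o => @model_action R n Phi lam W Uu j o) Uu) irr => [||j].
  + exact: V_tensor.
  + move=> j; rewrite /model_action; case: insubP => [j' _ _|_]; first by left; exists j'.
    by right.
  + exact: exists_unit_vector.
- exact: V_tensor.
Qed.

End normal_form.

(** * The structure scalars *)

Section twist_scalars.
Variables (R : realType) (n : nat) (H : hilbertType R).
Variables (U : 'I_n -> 'I_n -> bounded_operator H H) (V : 'I_n -> bounded_operator H H).
Local Notation C := R[i].
Hypothesis Uunit : commuting_unitaries U.
Hypothesis irr : irreducible_family V.
Hypothesis VU : forall i j k, i != j -> forall x,
  V k (twist U i j x) = twist U i j (V k x).

Lemma twist_adj i j : i != j -> adj (twist U i j) (twist U j i).
Proof.
rewrite /twist neq_ltn => /orP[ij|ji].
  by rewrite ij ltnNge (ltnW ij); exact: operator_adj.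
by rewrite ji ltnNge (ltnW ji); exact: adjC (operator_adj _).
Qed.

Lemma twistK i j : i != j -> cancel (twist U i j) (twist U j i).
Proof.
have [Uu _] := Uunit; rewrite /twist neq_ltn => /orP[ij|ji].
  by rewrite ij ltnNge (ltnW ij); have [] := Uu _ _ ij.
by rewrite ji ltnNge (ltnW ji); have [] := Uu _ _ ji.
Qed.

(** Each twist is a unitary commuting with the irreducible family, and the twists
    of (i, j) and (j, i) are adjoint to each other. *)
Lemma twist_scalars : exists lam : 'I_n -> 'I_n -> C,
  forall i j, i != j -> [/\ `|lam i j| = 1, lam j i = (lam i j)^* &
    forall x, twist U i j x = lam i j *: x].
Proof.
have scal (ij : 'I_n * 'I_n) : exists t : C,
    ij.1 != ij.2 -> forall x, twist U ij.1 ij.2 x = t *: x.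
  case: ij => i j /=; have [->|ij] := eqVneq i j; first by exists 0.
  have ji : j != i by rewrite eq_sym.
  have [t ht] := commutant_unitary_scalar irr (twist_adj ij) (twistK ij) (twistK ji)
    (fun k x => VU k ij x) (fun k x => VU k ji x).
  by exists t.
have [lam hlam] := choice scal.
exists (fun i j => lam (i, j)) => i j ij; have ji : j != i by rewrite eq_sym.
have h1 := hlam (i, j) ij; have h2 := hlam (j, i) ji.
have [[x0 x00] _] := irr.
have xx0 : inner x0 x0 != 0 by apply: contra_neq x00; exact: inner_eq0.
have lamC : lam (j, i) = (lam (i, j))^*.
  apply: (mulIf xx0); rewrite -innerZl -h2/= (twist_adj ji) h1/= innerZr.
  by [].
split=> //.
apply/eqP; rewrite -sqrp_eq1// normCK -lamC; apply/eqP.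
apply: (mulIf xx0); rewrite -mulrA -!innerZl -h2 -h1/=.
by rewrite (twistK ji) scale1r.
Qed.

End twist_scalars.

Theorem theorem5p2 (R : realType) (n : nat) (H : hilbertType R)
    (U : 'I_n -> 'I_n -> bounded_operator H H)
    (V : 'I_n -> bounded_operator H H) :
  (1 < n)%N ->
  commuting_unitaries U ->
  twisted_power_partial_isometry U V ->
  irreducible_family V ->
  exists (lam : 'I_n -> 'I_n -> R[i]) (Phi : 'I_n -> part)
    (Hu : hilbertType R) (Uu : index_u Phi -> bounded_operator Hu Hu)
    (K : tensor_product (@model_factor R n Phi Hu))
    (W : 'I_n -> bounded_operator K K),
  [/\ (forall i j, i != j ->
        [/\ `|lam i j| = 1, lam j i = (lam i j)^* &
          forall x, twist U i j x = lam i j *: x]),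
      (forall i p, Phi i = Phi_ p -> (0 < p)%N),
      [/\ forall i, unitary_operator (Uu i),
          irreducible_family Uu &
          forall i j, i != j -> forall y,
            adjoint (Uu i) (Uu j y) =
              lam (val i) (val j) *: Uu j (adjoint (Uu i) y)],
      (forall j (x : forall o, model_factor Hu o),
        W j (tens K x) = tens K (fun o => model_action lam Uu j (x o))) &
      unitarily_equivalent V W].
Proof.
move=> _ Uunit [ppV V'V VV VU] irr.
have [lam lamP] := twist_scalars Uunit irr VU.
have lam_norm i j : i != j -> `|lam i j| = 1 by move=> /lamP[].
have lam_conj i j : i != j -> lam j i = (lam i j)^* by move=> /lamP[].
have twE i j : i != j -> forall x, twist U i j x = lam i j *: x by move=> /lamP[].
have V'V' i j : i != j -> forall x,
    adjoint (V i) (V j x) = lam i j *: V j (adjoint (V i) x).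
  by move=> ij x; rewrite V'V// twE.
have VV' i j : i != j -> forall x, V i (V j x) = lam j i *: V j (V i x).
  by move=> ij x; rewrite VV// twE// eq_sym.
have [Phi hPhi] := choice (fun i => exists_part lam_norm lam_conj V'V' VV' irr (ppV i)).
have [Q spec] := choice hPhi.
have [Uu UuE] := choice (fun j : index_u Phi =>
  osub_operator (V_vacuum lam_norm lam_conj V'V' VV' spec (valP j))).
have [K [W [Uirr WE VW]]] := normal_form_tensor lam_norm lam_conj V'V' VV' irr spec UuE.
exists lam, Phi, (osub (vacuum_perp Phi Q)), Uu, K, W; split=> //.
  by move=> i p ip; have := spec i; rewrite ip => -[].
split=> //; first exact: (Uu_unitary lam_norm lam_conj V'V' VV' spec UuE).
by move=> i j ij y; apply: (Uu_twisted lam_norm lam_conj V'V' VV' spec UuE).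
Qed.
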